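(* Let $K$ be a compact subset of the unit circle $\mathbb{T}$ of arclength measure $0$ and let $L$ be a compact subset of the open unit disc $\mathbb{D}$. Let $\varphi: K\to\mathbb{C}$ be a continuous function with $|\varphi(z)|=1$ for all $z\in K$, and let $f$ be a holomorphic function on $\mathbb{D}$ with $\sup_{z\in\mathbb{D}}|f(z)|\le 1$. Let $\varepsilon>0$. Then there exists a finite Blaschke product $B$ such that $$\|B-\varphi\|_K<\varepsilon\quad\text{and}\quad \|B-f\|_L<\varepsilon.$$
   Context: $\mathbb{D}$ is the open unit disc in $\mathbb{C}$ and $\mathbb{T}=\partial\mathbb{D}$. A finite Blaschke product is a function of the form $B(z)=\zeta\prod_{k=0}^{n}\frac{z-w_k}{1-\overline{w_k}z}$ with $w_0,\dots,w_n\in\mathbb{D}$ and $\zeta\in\mathbb{T}$; it is regarded as a continuous function on $\overline{\mathbb{D}}$ via the same formula. For a compact set $E\subset\mathbb{C}$ and a continuous function $g$ on $E$, $\|g\|_E=\sup_{z\in E}|g(z)|$ (understood as $0$ if $E=\emptyset$). *)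

(* Defs.v *)
From HB Require Import structures.
From mathcomp Require Import all_boot all_order all_algebra.
From mathcomp Require Import complex.
From mathcomp Require Import all_classical all_reals all_analysis.

Set Implicit Arguments.
Unset Strict Implicit.
Unset Printing Implicit Defensive.

Import Order.TTheory GRing.Theory Num.Theory.
Import numFieldNormedType.Exports.

Local Open Scope classical_set_scope.
Local Open Scope ring_scope.

(* The topology of R[i] is the one of its norm, and R[i] is a normed module
   over itself: [derivable] on R[i] is therefore complex differentiability. *)
#[warnings="-redundant-canonical-projection"]
HB.instance Definition _ (R : realType) := PseudoPointedMetric.copy R[i] R[i]^o.
#[warnings="-redundant-canonical-projection"]
HB.instance Definition _ (R : realType) := NormedModule.copy R[i] R[i]^o.

Definition unit_disc (R : realType) : set R[i] := [set z | `|z| < 1].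

Definition closed_unit_disc (R : realType) : set R[i] := [set z | `|z| <= 1].

Definition unit_circle (R : realType) : set R[i] := [set z | `|z| = 1].

Arguments unit_disc R : clear implicits.
Arguments closed_unit_disc R : clear implicits.
Arguments unit_circle R : clear implicits.

Definition expi (R : realType) (t : R) : R[i] := Complex (cos t) (sin t).

(* Only meaningful when A is a subset of the unit circle. *)
Definition arclength (R : realType) (A : set R[i]) : \bar R :=
  lebesgue_measure [set t : R | 0 <= t < 2 * pi /\ A (expi t)].

(* The norm of R[i] takes its values in R[i]; [complex.Re] brings it back to R.
   The supremum is taken in \bar R, so that an unbounded g has norm +oo; the
   maximum with 0 only matters when E is empty. *)
Definition supnorm (R : realType) (E : set R[i]) (g : R[i] -> R[i]) : \bar R :=
  maxe 0%E (ereal_sup [set (complex.Re `|g z|)%:E | z in E]).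

Definition holomorphic_on (R : realType) (U : set R[i]) (f : R[i] -> R[i]) :=
  forall z, U z -> derivable f z 1.

Definition blaschke (R : realType) (n : nat) (zeta : R[i])
    (w : 'I_n.+1 -> R[i]) (z : R[i]) : R[i] :=
  zeta * \prod_(k < n.+1) ((z - w k) / (1 - (w k)^*%C * z)).

Definition finite_blaschke (R : realType) (B : R[i] -> R[i]) :=
  exists (n : nat) (zeta : R[i]) (w : 'I_n.+1 -> R[i]),
    [/\ unit_circle R zeta, forall k, unit_disc R (w k)
      & forall z, closed_unit_disc R z -> B z = blaschke zeta w z].

(* Main.v *)
(* If finitely many disjoint arcs of total length l cover K, and A, D are the
   monic polynomials with simple roots at their right and left end points, then
   (A - e^(il) D) / (A - D) is a finite Blaschke product which vanishes at 0 and
   is within l of 1 on K; it is therefore z v with v inner and v close to 1 / z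
   on K, and z^m v^(m + d) is close to 1 / z^d on K and small on L.

   A continuous unimodular psi on K is uniformly close to rho^4 with rho
   unimodular, Re rho > 0 and rho locally constant near a finite cover of K by
   arcs. A trigonometric polynomial t close to rho / 2 - 1 on K (a Fejer mean)
   then has |t| < 1 on the circle and (t + 1) / (1 + t^* ) close to rho / rho^*
   = rho^2. Since t = z^(-d) P with P a polynomial, replacing 1 by an inner
   function close to 1 on K and divisible by a high power of z turns this into
   an inner function, whose square is close to psi on K and small on L.

   On L, f is close to a polynomial g with |g| < 1 on the closed disc: a Fejer
   mean of f on a circle of radius close to 1, its Fourier coefficients of
   negative index vanishing by Goursat's argument. With
   psi = z^(-d) (phi - g) / (1 - g^* phi) and v inner, close to psi on K and
   small on L, B = (g + z^d v) / (1 + g^* z^d v) is the required product, where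
   g^* z^d coincides on the circle with a polynomial. *)

Require Import Defs.
From mathcomp Require Import all_boot all_order all_algebra.
From mathcomp Require Import complex.
From mathcomp Require Import all_classical all_reals all_analysis.
From mathcomp Require Import measurable_realfun.
From mathcomp Require Import ring lra zify.

Import Order.TTheory GRing.Theory Num.Theory.
Import numFieldNormedType.Exports.

Local Open Scope classical_set_scope.
Local Open Scope ring_scope.

(** * The real-valued modulus, the exponential on the circle, and roots of unity *)

Section ComplexNumbers.
Set Implicit Arguments.
Unset Strict Implicit.
Context {R : realType}.
Local Notation C := R[i].
Implicit Types (z w : C) (a b t : R).

(** A Möbius quotient with parameter $t$ is stable only while $|t|$ stays below a constant smaller
    than 1. For unimodular $c$ one has $|c/2-1|^2 = 5/4 - \mathrm{Re}\,c$; a square root of the data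
    may have real part 0, whereas a fourth root can be chosen with real part at least $1/2$. Hence
    the fourth powers: the quotient yields $c^2$, and squaring it restores $c^4$. The negative
    powers of $z$ in a trigonometric polynomial are the other obstacle, since they have a pole in
    the disc; this is what the imitation of $z^{-d}$ on $K$ is for.

    Only finite sums occur. A quotient $P/Q$ is recognised as a Blaschke product by two checks: $P$
    is the reflection of $Q$ on the circle, and $Q$ has no zero in the closed disc. Means over roots
    of unity replace integrals over circles, and contour integrals become trapezoid sums with $2^m$
    steps per side, so that bisecting a cell is an exact identity. *)

Definition nm z : R := complex.Re `|z|.

Lemma nmE z : `|z| = (nm z)%:C%C.
Proof. by rewrite /nm normc_def. Qed.

Lemma nm_ge0 z : 0 <= nm z.
Proof. by rewrite -ler0c -nmE normr_ge0. Qed.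

Lemma nmM z w : nm (z * w) = nm z * nm w.
Proof. by apply: complexI; rewrite rmorphM /= -!nmE normrM. Qed.

Lemma nmD z w : nm (z + w) <= nm z + nm w.
Proof. by rewrite -lecR rmorphD /= -!nmE ler_normD. Qed.

Lemma nmN z : nm (- z) = nm z.
Proof. by rewrite /nm normrN. Qed.

Lemma nmC z w : nm (z - w) = nm (w - z).
Proof. by rewrite -nmN opprB. Qed.

Lemma nmB z w : nm (z - w) <= nm z + nm w.
Proof. by rewrite -(nmN w) nmD. Qed.

Lemma nm_le_sub z w : nm z <= nm w + nm (z - w).
Proof. by apply: le_trans (nmD _ _); rewrite addrC subrK. Qed.

Lemma nm_tri x y z : nm (x - z) <= nm (x - y) + nm (y - z).
Proof. by apply: le_trans (nmD _ _); rewrite addrA subrK. Qed.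

Lemma nm0 : nm 0 = 0.
Proof. by rewrite /nm normr0. Qed.

Lemma nm1 : nm 1 = 1.
Proof. by rewrite /nm normr1. Qed.

Lemma nm0_eq0 z : (nm z == 0) = (z == 0).
Proof. by rewrite -[RHS]normr_eq0 nmE -(inj_eq (@complexI R)). Qed.

Lemma nm_gt0 z : (0 < nm z) = (z != 0).
Proof. by rewrite lt0r nm0_eq0 nm_ge0 andbT. Qed.

Lemma nmV z : nm z^-1 = (nm z)^-1.
Proof. by apply: complexI; rewrite fmorphV /= -!nmE normfV. Qed.

Lemma nm_div z w : nm (z / w) = nm z / nm w.
Proof. by rewrite nmM nmV. Qed.

Lemma nmX z n : nm (z ^+ n) = nm z ^+ n.
Proof. by apply: complexI; rewrite rmorphXn /= -!nmE normrX. Qed.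

Lemma nm_conj z : nm (conjc z) = nm z.
Proof. by rewrite /nm normcJ. Qed.

Lemma nm_real a : nm a%:C%C = `|a|.
Proof. by rewrite /nm normc_def /= expr0n /= addr0 sqrtr_sqr. Qed.

Lemma nm_nat n : nm (n%:R : C) = n%:R.
Proof. by rewrite -(rmorph_nat (real_complex R)) nm_real ger0_norm. Qed.

Lemma nm_prod (I : Type) (r : seq I) (P : pred I) (F : I -> C) :
  nm (\prod_(i <- r | P i) F i) = \prod_(i <- r | P i) nm (F i).
Proof. by elim/big_rec2: _ => [|i x y _ <-]; rewrite ?nm1 ?nmM. Qed.

Lemma nm_sum (I : Type) (r : seq I) (P : pred I) (F : I -> C) :
  nm (\sum_(i <- r | P i) F i) <= \sum_(i <- r | P i) nm (F i).
Proof.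
elim/big_rec2: _ => [|i x y _ le_xy]; first by rewrite nm0.
by apply: le_trans (nmD _ _) _; rewrite lerD2l.
Qed.

Lemma mul_conj z : z * conjc z = (nm z ^+ 2)%:C%C.
Proof. by rewrite rmorphXn /= -nmE sqr_normc. Qed.

Lemma nm_sq z : nm z ^+ 2 = complex.Re z ^+ 2 + complex.Im z ^+ 2.
Proof.
apply: complexI; rewrite -mul_conj; case: z => x y /=.
by apply/eqP; rewrite eq_complex /=; apply/andP; split; apply/eqP; ring.
Qed.

Lemma conj_unit z : nm z = 1 -> conjc z = z^-1.
Proof.
move=> z1; have z0 : z != 0 by rewrite -nm_gt0 z1.
by apply: (mulfI z0); rewrite mul_conj z1 expr1n mulfV.
Qed.

Lemma unit_neq0 z : nm z = 1 -> z != 0.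
Proof. by move=> z1; rewrite -nm_gt0 z1. Qed.

Lemma norm_eq1 z : `|z| = 1 <-> nm z = 1.
Proof. by rewrite nmE; split => [[]|->]. Qed.

Lemma norm_lt1 z : (`|z| < 1) = (nm z < 1).
Proof. by rewrite nmE (ltcR _ 1). Qed.

Lemma norm_le1 z : (`|z| <= 1) = (nm z <= 1).
Proof. by rewrite nmE (lecR _ 1). Qed.

Lemma expi0 : expi (0 : R) = 1.
Proof. by rewrite /expi cos0 sin0. Qed.

Lemma expiD a b : expi (a + b) = expi a * expi b.
Proof.
apply/eqP; rewrite eq_complex /= cosD sinD.
by apply/andP; split; apply/eqP; ring.
Qed.

Lemma nm_expi a : nm (expi a) = 1.
Proof.
apply/eqP; rewrite -(@eqrXn2 _ 2) ?nm_ge0 // nm_sq /= expr1n.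
by rewrite cos2Dsin2.
Qed.

Lemma expi_neq0 a : expi a != 0.
Proof. exact/unit_neq0/nm_expi. Qed.

Lemma expiN a : expi (- a) = (expi a)^-1.
Proof.
by apply: (mulfI (expi_neq0 a)); rewrite -expiD subrr expi0 mulfV ?expi_neq0.
Qed.

Lemma expiB a b : expi (a - b) = expi a / expi b.
Proof. by rewrite expiD expiN. Qed.

Lemma expi_conj a : conjc (expi a) = expi (- a).
Proof. by rewrite expiN conj_unit ?nm_expi. Qed.

Lemma expiX a n : expi a ^+ n = expi (n%:R * a).
Proof.
elim: n => [|n IHn]; first by rewrite mul0r expi0.
by rewrite exprS IHn -expiD -natr1 mulrDl mul1r addrC.
Qed.

Lemma expi_sum (I : Type) (r : seq I) (P : pred I) (F : I -> R) :
  expi (\sum_(i <- r | P i) F i) = \prod_(i <- r | P i) expi (F i).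
Proof. by elim/big_rec2: _ => [|i x y _ <-]; rewrite ?expi0 ?expiD. Qed.

Lemma expi2pi : expi (2 * pi : R) = 1.
Proof. by rewrite /expi mulrC mulr_natr cos2pi sin2pi. Qed.

(** A chord is a real sine times a phase at the mean angle, so that signs and arguments of products
    of chords can be handled separately. *)
Lemma expi_chord a b :
  expi a - expi b = 2 * 'i%C * (sin ((a - b) / 2))%:C%C * expi ((a + b) / 2).
Proof.
have -> : expi a = expi ((a + b) / 2 + (a - b) / 2) by congr expi; field.
have -> : expi b = expi ((a + b) / 2 - (a - b) / 2) by congr expi; field.
set u := (a + b) / 2; set v := (a - b) / 2.
apply/eqP; rewrite eq_complex /= cosD sinD cosB sinB.
by apply/andP; split; apply/eqP; ring.
Qed.

Lemma nm_i : nm ('i%C : C) = 1.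
Proof. by apply/eqP; rewrite -(@eqrXn2 _ 2) ?nm_ge0 // nm_sq /= expr0n expr1n add0r. Qed.

Lemma nm_chord a b : nm (expi a - expi b) = 2 * `|sin ((a - b) / 2)|.
Proof. by rewrite expi_chord !nmM nm_expi nm_real nm_i nm_nat !mulr1. Qed.

Lemma abs_sin_le a : `|sin a| <= `|a|.
Proof.
wlog a0 : a / 0 <= a => [hw|].
  have [/hw //|/ltW an] := leP 0 a.
  by rewrite -normrN -sinN -(normrN a); apply: hw; lra.
rewrite (ger0_norm a0) ler_norml.
have key (x : R) : 0 <= x -> (x - sin x >= 0) /\ (x + sin x >= 0).
  move=> x0; have hder (f df : R -> R) : (forall y : R, is_derive y (1 : R) f (df y)) ->
      (forall y, 0 <= df y) -> f 0 = 0 -> 0 <= f x.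
    move=> fd df0 f0.
    have fc : {within `[0, x], continuous f}.
      apply: continuous_subspaceT => y; apply: differentiable_continuous.
      by apply/derivable1_diffP; have [] := fd y.
    have [y _ +] := MVT_segment x0 (fun y _ => fd y) fc.
    by rewrite f0 !subr0 => ->; rewrite mulr_ge0.
  split.
    apply: (hder (fun y => y - sin y) (fun y => 1 - cos y)) => [y|].
    - by rewrite subr_ge0 cos_le1.
    - by rewrite sin0 subr0.
  apply: (hder (fun y => y + sin y) (fun y => 1 + cos y)) => [y|].
  - by have := cos_geN1 y; lra.
  - by rewrite sin0 addr0.
by have [] := key a a0; lra.
Qed.

Lemma expi_lip a b : nm (expi a - expi b) <= `|a - b|.
Proof.
rewrite nm_chord; have := abs_sin_le ((a - b) / 2).
by rewrite normrM (@ger0_norm _ 2^-1) ?invr_ge0 //; lra.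
Qed.

Lemma expi_onto z t0 : nm z = 1 ->
  exists2 t, t0 <= t < t0 + 2 * pi & z = expi t.
Proof.
move=> z1.
have pi0 := pi_gt0 R.
have [t zt] : exists t, z = expi t.
  have := nm_sq z; rewrite z1 expr1n; case: z z1 => x y /= _ xy.
  have x1 : -1 <= x <= 1 by rewrite -ler_norml -(@ler_pXn2r _ 2) ?nnegrE //
     real_normK ?num_real // expr1n xy lerDl sqr_ge0.
  have [y0|y0] := leP 0 y.
    exists (acos x); rewrite /expi acosK // sin_acos // xy addrAC subrr add0r.
    by rewrite sqrtr_sqr ger0_norm.
  exists (- acos x); rewrite /expi cosN sinN acosK // sin_acos //.
  by rewrite xy addrAC subrr add0r sqrtr_sqr ltr0_norm // opprK.
pose n := Num.floor ((t - t0) / (2 * pi)).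
have expin (m : int) : expi (m%:~R * (2 * pi) : R) = 1.
  have expinn (k : nat) : expi (k%:R * (2 * pi) : R) = 1.
    by rewrite -expiX expi2pi expr1n.
  by case: m => k; rewrite ?NegzE ?mulrNz ?mulNr ?expiN !expinn ?invr1.
exists (t - n%:~R * (2 * pi)); last by rewrite expiB expin divr1.
have /andP[h1 h2] := floor_itv ((t - t0) / (2 * pi)).
rewrite -/n in h1 h2; have pi20 : 0 < 2 * pi :> R by lra.
rewrite ler_pdivlMr // in h1; rewrite intrD ltr_pdivrMr // in h2.
by lra.
Qed.

Lemma conjcB z w : conjc (z - w) = conjc z - conjc w.
Proof. exact: rmorphB. Qed.

Lemma conjcM z w : conjc (z * w) = conjc z * conjc w.
Proof. exact: rmorphM. Qed.

Lemma conjcX z n : conjc (z ^+ n) = conjc z ^+ n.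
Proof. exact: rmorphXn. Qed.

Definition unity_root (M : nat) : C := expi (2 * pi / M%:R).

Lemma nm_unity M : nm (unity_root M) = 1.
Proof. exact: nm_expi. Qed.

Lemma unity_neq0 M : unity_root M != 0.
Proof. exact: expi_neq0. Qed.

Lemma unity_rootX M j : unity_root M ^+ j = expi (2 * pi * j%:R / M%:R).
Proof. by rewrite expiX; congr expi; rewrite mulrCA !mulrA mulrAC. Qed.

Lemma unity_root1 M : (0 < M)%N -> unity_root M ^+ M = 1.
Proof. by move=> M0; rewrite unity_rootX mulfK ?expi2pi // pnatr_eq0 -lt0n. Qed.

Lemma unity_root_neq1 M k : (0 < k < M)%N -> unity_root M ^+ k != 1.
Proof.
move=> /andP[k0 kM]; have M0 : (0 < M)%N by apply: leq_trans kM.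
have pi0 := pi_gt0 R.
have MR : 0 < M%:R :> R by rewrite ltr0n.
rewrite unity_rootX -expi0 -subr_eq0 -nm0_eq0 nm_chord subr0.
rewrite mulf_neq0 // normr_eq0 gt_eqF // sin_gt0_pi //.
have -> : 2 * pi * k%:R / M%:R / 2 = pi * (k%:R / M%:R) :> R by field; lra.
have k01 : 0 < k%:R / M%:R :> R /\ k%:R / M%:R < 1 :> R.
  by rewrite divr_gt0 ?ltr0n // ltr_pdivrMr // mul1r ltr_nat.
move: k01; set x : R := k%:R / M%:R => - [x0 x1].
by apply/andP; split; nra.
Qed.

Lemma sum_unity_root M k : (0 < k < M)%N ->
  \sum_(j < M) unity_root M ^+ (k * j) = 0.
Proof.
move=> kM; have /andP[k0 kM'] := kM; have M0 := leq_trans (ltn0Sn _) kM'.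
have := subrX1 (unity_root M ^+ k) M.
rewrite -exprM mulnC exprM unity_root1 // expr1n subrr => /esym/eqP.
rewrite mulf_eq0 subr_eq0 (negbTE (unity_root_neq1 kM)) /= => /eqP {2}<-.
by apply: eq_bigr => j _; rewrite exprM.
Qed.

End ComplexNumbers.

Section InnerFunctions.
Set Implicit Arguments.
Unset Strict Implicit.
Context {R : realType}.
Local Notation C := R[i].
Implicit Types (z w c : C) (P Q p q : {poly C}) (u v : C -> C).

(** Summing over the [M]-th roots of unity kills every monomial of degree strictly between 0 and
    [M]: the mean value property is exact without an integral. *)
Lemma sum_poly_unity_root p M : (0 < M)%N -> (size p <= M)%N ->
  \sum_(j < M) p.[unity_root M ^+ j] = M%:R * p.[0].
Proof.
case: M => // M _ sp; set W := unity_root M.+1.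
under eq_bigr => j _ do rewrite (horner_coef_wide _ sp).
rewrite exchange_big big_ord_recl /=.
rewrite [X in _ + X]big1 ?addr0 => [|i _].
  under eq_bigr => j _ do rewrite expr0 mulr1.
  by rewrite sumr_const card_ord horner_coef0 mulr_natl.
under eq_bigr => j _ do rewrite -exprM mulnC.
rewrite -mulr_sumr (@sum_unity_root R M.+1) ?mulr0 //.
by rewrite /bump add1n /= ltnS ltn_ord.
Qed.

Lemma poly_mean p z c M : (size p < M)%N ->
  \sum_(j < M) p.[z + c * unity_root M ^+ j] = M%:R * p.[z].
Proof.
move=> sp; pose q := p \Po (c *: 'X + z%:P).
have qE x : q.[x] = p.[z + c * x].
  by rewrite horner_comp hornerD hornerZ hornerX hornerC addrC.
have -> : p.[z] = q.[0] by rewrite qE mulr0 addr0.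
rewrite -sum_poly_unity_root ?(leq_trans _ sp) //.
  by apply: eq_bigr => j _; rewrite qE.
apply: leq_trans (size_comp_poly_leq _ _) _.
set l := c *: 'X + z%:P; suff sl : (size l <= 2)%N.
  by move: (size l) sl => k k2; case: (size p) sp => [|n] /= nM; nia.
apply: leq_trans (size_polyD _ _) _; rewrite geq_max.
rewrite (leq_trans (size_scale_leq _ _)) ?size_polyX //=.
by rewrite (leq_trans (size_polyC_leq1 _)).
Qed.

Lemma nm_horner_le p z : nm z <= 1 -> nm p.[z] <= \sum_(i < size p) nm p`_i.
Proof.
move=> z1; rewrite horner_coef; apply: le_trans (nm_sum _ _ _) _.
apply: ler_sum => i _; rewrite nmM nmX ler_piMr ?nm_ge0 //.
by rewrite exprn_ile1 ?nm_ge0.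
Qed.

(* The mean over a circle centred at z and touching the unit circle at one of
   its M nodes gives M |p(z)| <= (M - 1) S + b, where S is the supremum of |p|
   over the disc. *)
Lemma poly_max_principle p (b : R) : (forall z, nm z = 1 -> nm p.[z] <= b) ->
  forall z, nm z <= 1 -> nm p.[z] <= b.
Proof.
move=> pb; pose E := [set nm p.[z] | z in [set z : C | nm z <= 1]].
have E0 : E !=set0 by exists (nm p.[0]), 0; rewrite //= nm0 ler01.
have ubE : has_ubound E.
  exists (\sum_(i < size p) nm p`_i) => _ [z /= z1 <-].
  exact: nm_horner_le.
have Esup z : nm z <= 1 -> nm p.[z] <= sup E.
  by move=> z1; apply: ub_le_sup => //; exists z.
suff sb : sup E <= b by move=> z /Esup /le_trans; apply.
pose M := (size p).+1.
have key z : nm z <= 1 -> M%:R * nm p.[z] <= (M%:R - 1) * sup E + b.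
  move=> z1.
  have [d [d1 zd]] : exists d, nm d = 1 /\ nm (z + (1 - nm z)%:C%C * d) = 1.
    have [->|z0] := eqVneq z 0.
      by exists 1; rewrite nm1 nm0 subr0 add0r mulr1 nm_real normr1.
    have nz : nm z != 0 by rewrite nm0_eq0.
    exists (z / (nm z)%:C%C).
    rewrite nm_div nm_real ger0_norm ?nm_ge0 // divff //; split => //.
    have nzC : (nm z)%:C%C != 0 by rewrite -(inj_eq (@complexI R)) in nz.
    have -> : z + (1 - nm z)%:C%C * (z / (nm z)%:C%C) = z / (nm z)%:C%C.
      by rewrite rmorphB rmorph1; field.
    by rewrite nm_div nm_real ger0_norm ?nm_ge0 // divff.
  have := @poly_mean p z ((1 - nm z)%:C%C * d) M (ltnSn _).
  move=> /(congr1 nm); rewrite nmM nm_nat => <-.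
  apply: le_trans (nm_sum _ _ _) _.
  rewrite big_ord_recl /= expr0 mulr1 addrC lerD //; last exact: pb.
  have -> : (M%:R - 1) * sup E = \sum_(i < size p) sup E.
    by rewrite sumr_const card_ord /M -natr1 addrK mulr_natl.
  apply: ler_sum => j _; apply: Esup.
  apply: le_trans (nmD _ _) _.
  rewrite !nmM nm_real nmX nm_unity expr1n d1 !mulr1 ger0_norm ?subr_ge0 //.
  by rewrite addrC subrK.
have M0 : 0 < M%:R :> R by rewrite ltr0n.
suff : sup E <= ((M%:R - 1) * sup E + b) / M%:R.
  by rewrite ler_pdivlMr // mulrC; lra.
apply: ge_sup => // _ [z /= z1 <-].
by rewrite ler_pdivlMr // mulrC key.
Qed.

Lemma poly_circle_eq0 p : (forall z, nm z = 1 -> p.[z] = 0) -> p = 0.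
Proof.
move=> p0; apply/eqP; apply: contraT => pn0.
pose rs := [seq unity_root (R := R) (size p) ^+ i | i <- iota 0 (size p)].
have sp : (0 < size p)%N by rewrite size_poly_gt0.
suff : (size rs < size p)%N by rewrite size_map size_iota ltnn.
apply: max_poly_roots => //.
  by apply/allP => _ /mapP[i _ ->]; apply/rootP/p0; rewrite nmX nm_unity expr1n.
rewrite map_inj_in_uniq ?iota_uniq // => i j; rewrite !mem_iota /= !add0n.
wlog ij : i j / (i <= j)%N => [hw|].
  by case: (leqP i j) => [|/ltnW] /hw // + ? ? ? => h; apply/esym/h.
move=> ip jp /esym/eqP; rewrite -(subnKC ij) exprD.
rewrite -[X in _ == X]mulr1 (inj_eq (mulfI _)) ?expf_neq0 ?unity_neq0 //.
have [->|n0] := posnP (j - i); first by rewrite addn0.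
rewrite (negPf (unity_root_neq1 _)) // n0 /=.
exact: leq_ltn_trans (leq_subr _ _) jp.
Qed.

Lemma poly_circle_eq p q : (forall z, nm z = 1 -> p.[z] = q.[z]) -> p = q.
Proof.
move=> pq; apply/eqP; rewrite -subr_eq0; apply/eqP/poly_circle_eq0 => z z1.
by rewrite hornerD hornerN pq // subrr.
Qed.

(* The finite Blaschke products of degree N, constants being allowed for
   N = 0. *)
Definition inner N u := exists (c : C) (s : seq C),
  [/\ nm c = 1, size s = N, {in s, forall w, nm w < 1}
    & forall z, nm z <= 1 ->
        u z = c * \prod_(w <- s) ((z - w) / (1 - conjc w * z))].

(* On the circle z^N (Q z)^* is the value at z of the polynomial obtained by
   reversing and conjugating the coefficients of Q. *)
Definition reflected N c P Q :=
  nm c = 1 /\ forall z, nm z = 1 -> P.[z] = c * z ^+ N * conjc Q.[z].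

(** Reflecting the factorisation of $P$ over its zeros $w$ exhibits $Q$ as a constant times $\prod
    (1-\bar w z)$. A zero $w$ of modulus at least 1 would give $Q$ the zero $1/\bar w$ in the closed
    disc. *)
Lemma inner_of_reflected N c P Q : reflected N c P Q ->
  (forall z, nm z <= 1 -> Q.[z] != 0) -> inner N (fun z => P.[z] / Q.[z]).
Proof.
move=> [c1 PQ] Qn0; have c0 := unit_neq0 c1.
have QP z : nm z = 1 -> Q.[z] = c * z ^+ N * conjc P.[z].
  move=> z1; rewrite PQ // !rmorphM /= rmorphXn /= (conj_unit c1) (conj_unit z1) conjcK.
  by rewrite exprVn; field; rewrite expf_neq0 ?c0 // unit_neq0.
have [s Ps] := closed_field_poly_normal P; set k := lead_coef P in Ps.
have k0 : k != 0.
  rewrite lead_coef_eq0; apply/eqP => P0.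
  suff : Q.[1] == 0 by apply/negP/Qn0; rewrite nm1.
  by rewrite QP ?nm1 // P0 horner0 conjc0 mulr0.
pose T : {poly C} := conjc k *: \prod_(w <- s) (1 - conjc w *: 'X).
have PE z : P.[z] = k * \prod_(w <- s) (z - w).
  rewrite Ps hornerZ horner_prod; congr (_ * _).
  by apply: eq_bigr => w _; rewrite hornerXsubC.
have TE z : T.[z] = conjc k * \prod_(w <- s) (1 - conjc w * z).
  rewrite hornerZ horner_prod; congr (_ * _); apply: eq_bigr => w _.
  by rewrite hornerD hornerN hornerZ hornerX hornerC.
have conjP z : nm z = 1 -> z ^+ size s * conjc P.[z] = T.[z].
  move=> z1; rewrite PE TE rmorphM /= mulrCA; congr (_ * _).
  rewrite rmorph_prod /=; elim: (s) => [|w r IHr]; first by rewrite !big_nil mulr1.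
  rewrite !big_cons /= exprS mulrACA IHr; congr (_ * _).
  by rewrite rmorphB /= conj_unit // mulrBr mulfV ?unit_neq0 // mulrC.
(* The identity holds on the circle, hence between polynomials. *)
have QT : 'X^(size s) * Q = c *: ('X^N * T).
  apply: poly_circle_eq => z z1.
  rewrite hornerZ !hornerM !hornerXn -conjP // QP //.
  by ring.
have T0 : T.[0] != 0.
  rewrite TE big1 => [|w _]; last by rewrite mulr0 subr0.
  by rewrite mulr1 conjc_eq0.
have Xn0 n : ('X^n : {poly C}) != 0 by rewrite monic_neq0 ?monicXn.
(* Neither $Q$ nor $T$ vanishes at 0, so the powers of $X$ on the two sides of [QT] agree. *)
have sN : size s = N.
  apply/eqP; rewrite eqn_leq; apply/andP; split; rewrite leqNgt; apply/negP => h.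
    have : 'X^(size s - N) * Q = c *: T.
      apply: (mulfI (Xn0 N)); rewrite mulrA -exprD subnKC ?(ltnW h) // QT.
      by rewrite scalerAr.
    move=> /(congr1 (fun p => p.[0])) /eqP.
    rewrite hornerM hornerXn hornerZ expr0n subn_eq0 leqNgt h /= mul0r eq_sym.
    by rewrite mulf_eq0 (negPf c0) (negPf T0).
  have : Q = c *: ('X^(N - size s) * T).
    apply: (mulfI (Xn0 (size s))); rewrite QT -[RHS]scalerAr mulrA -exprD.
    by rewrite subnKC ?(ltnW h).
  move=> /(congr1 (fun p => p.[0])) /eqP.
  rewrite hornerZ hornerM hornerXn expr0n subn_eq0 leqNgt h /= mul0r mulr0.
  by apply/negP/Qn0; rewrite nm0.
have QcT : Q = c *: T.
  by apply: (mulfI (Xn0 N)); rewrite -{1}sN QT scalerAr.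
have s1 : {in s, forall w, nm w < 1}.
  move=> w ws; rewrite ltNge; apply/negP => w1.
  have w0 : w != 0 by rewrite -nm_gt0 (lt_le_trans _ w1).
  suff : Q.[(conjc w)^-1] == 0.
    by apply/negP/Qn0; rewrite nmV nm_conj invf_le1 // (lt_le_trans _ w1).
  rewrite QcT hornerZ TE (big_rem w) //= divff ?conjc_eq0 // subrr mul0r.
  by rewrite !mulr0.
exists (k / (c * conjc k)), s; split => //.
  by rewrite nm_div nmM nm_conj c1 mul1r divff // nm0_eq0.
move=> z z1; rewrite PE QcT hornerZ TE big_split /= prodfV.
by rewrite !invfM; ring.
Qed.

(** $|1-\bar w z|^2 - |z-w|^2 = (1-|w|^2)(1-|z|^2)$. *)
Lemma schwarz_factor w z : nm w < 1 -> nm z <= 1 ->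
  1 - conjc w * z != 0 /\ nm (z - w) <= nm (1 - conjc w * z).
Proof.
move=> w1 z1; split.
  rewrite subr_eq0; apply/eqP => /(congr1 nm); rewrite nmM nm_conj nm1 => h.
  have := nm_ge0 w; have := nm_ge0 z; nra.
rewrite -(@ler_pXn2r _ 2) ?nnegrE ?nm_ge0 // !nm_sq.
have := nm_sq w; have := nm_sq z.
have := nm_ge0 w; have := nm_ge0 z.
move: (nm w) (nm z) w1 z1 => a b; case: w z => [x y] [x' y'] /= a1 b1 b0 a0 bE aE.
rewrite -subr_ge0 [leRHS](_ : _ = (1 - a ^+ 2) * (1 - b ^+ 2)).
  by rewrite mulr_ge0 // subr_ge0 exprn_ile1 // ltW.
by rewrite aE bE; ring.
Qed.

Lemma inner_le1 N u z : inner N u -> nm z <= 1 -> nm (u z) <= 1.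
Proof.
move=> [c [s [c1 _ s1 uE]]] z1; rewrite uE // nmM c1 mul1r nm_prod.
elim: s s1 {uE} => [|w s IHs] s1; first by rewrite big_nil.
have [|wz0 wz] := @schwarz_factor w z _ z1; first by apply: s1; rewrite mem_head.
rewrite big_cons mulr_ile1 ?nm_ge0 ?prodr_ge0 // => [i _||]; first exact: nm_ge0.
  by rewrite nm_div ler_pdivrMr ?mul1r // nm_gt0.
by apply: IHs => x xs; apply: s1; rewrite inE xs orbT.
Qed.

(** Converse of [inner_of_reflected]: operations on inner functions can be carried out on numerators
    and denominators. *)
Lemma inner_frac N u : inner N u -> exists c P Q,
  [/\ reflected N c P Q, forall z, nm z <= 1 -> Q.[z] != 0
    & forall z, nm z <= 1 -> u z = P.[z] / Q.[z]].
Proof.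
move=> [c [s [c1 <- s1 uE]]].
pose P : {poly C} := c *: \prod_(w <- s) ('X - w%:P).
pose Q : {poly C} := \prod_(w <- s) (1 - conjc w *: 'X).
have PE z : P.[z] = c * \prod_(w <- s) (z - w).
  rewrite hornerZ horner_prod; congr (_ * _).
  by apply: eq_bigr => w _; rewrite hornerXsubC.
have QE z : Q.[z] = \prod_(w <- s) (1 - conjc w * z).
  rewrite horner_prod; apply: eq_bigr => w _.
  by rewrite hornerD hornerN hornerZ hornerX hornerC.
exists c, P, Q; split => [|z z1|z z1].
- split=> // z z1; rewrite PE QE -mulrA; congr (_ * _).
  rewrite rmorph_prod /=; elim: (s) => [|w r IHr]; first by rewrite !big_nil mulr1.
  rewrite !big_cons /= exprS mulrACA -IHr; congr (_ * _).
  rewrite rmorphB rmorphM rmorph1 /= conjcK conj_unit // mulrBr mulr1 mulrCA.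
  by rewrite mulfV ?unit_neq0 // mulr1.
- rewrite QE prodf_seq_neq0; apply/allP => w /s1 w1 /=.
  by have [] := schwarz_factor w1 z1.
- by rewrite uE // PE QE -mulrA -prodfV -big_split.
Qed.

Lemma inner_circle N u z : inner N u -> nm z = 1 -> nm (u z) = 1.
Proof.
move=> /inner_frac[c [P [Q [[c1 PQ] Q0 uE]]]] z1.
rewrite uE ?z1 // nm_div PQ // !nmM nmX nm_conj c1 z1 expr1n !mul1r divff //.
by rewrite nm0_eq0 Q0 ?z1.
Qed.

Lemma inner1 : inner 0 (fun=> 1).
Proof.
by exists 1, [::]; split=> // [|z _]; rewrite ?nm1 // big_nil mulr1.
Qed.

Lemma inner_id : inner 1 id.
Proof.
exists 1, [:: 0]; split=> // [|w|z _]; rewrite ?nm1 //.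
  by rewrite inE => /eqP->; rewrite nm0.
by rewrite big_seq1 conjc0 mul0r !subr0 divr1 mul1r.
Qed.

Lemma innerM N M u v : inner N u -> inner M v -> inner (N + M) (fun z => u z * v z).
Proof.
move=> [c [s [c1 sN s1 uE]]] [d [r [d1 rM r1 vE]]].
exists (c * d), (s ++ r); split.
- by rewrite nmM c1 d1 mulr1.
- by rewrite size_cat sN rM.
- by move=> w; rewrite mem_cat => /orP[/s1|/r1].
- by move=> z z1; rewrite uE // vE // big_cat /= mulrACA.
Qed.

Lemma innerX N u k : inner N u -> inner (k * N) (fun z => u z ^+ k).
Proof.
move=> uN; elim: k => [|k IHk].
  by rewrite mul0n; under eq_fun do rewrite expr0; exact: inner1.
by rewrite mulSn; under eq_fun do rewrite exprS; exact: innerM.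
Qed.

Lemma finite_blaschke_inner N u : inner N.+1 u -> finite_blaschke u.
Proof.
move=> [c [s [c1 sN s1 uE]]]; exists N, c, (fun k : 'I_N.+1 => nth 0 s k); split.
- exact/norm_eq1.
- by move=> k; rewrite /unit_disc /= norm_lt1 s1 // mem_nth // sN.
move=> z; rewrite /closed_unit_disc /= norm_le1 => z1.
by rewrite uE // /blaschke (big_nth 0) sN big_mkord.
Qed.

(* If |g| < 1 on the circle, then w |-> (g + z^d w) / (1 + g^* z^d w) is for
   each z on the circle an automorphism of the disc. *)
Lemma inner_mobius N d v (g h : {poly C}) (k : R) : inner N v -> k < 1 ->
  (forall z, nm z = 1 -> nm g.[z] <= k) ->
  (forall z, nm z = 1 -> h.[z] = z ^+ d * conjc g.[z]) ->
  [/\ inner (N + d) (fun z => (g.[z] + z ^+ d * v z) / (1 + h.[z] * v z)),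
      forall z, nm z <= 1 -> nm h.[z] <= k
    & forall z, nm z <= 1 -> 1 - k <= nm (1 + h.[z] * v z)].
Proof.
move=> vN k1 gk hE.
have hk : forall z, nm z <= 1 -> nm h.[z] <= k.
  apply: poly_max_principle => z z1.
  by rewrite hE // nmM nm_conj nmX z1 expr1n mul1r gk.
have den z : nm z <= 1 -> 1 - k <= nm (1 + h.[z] * v z).
  move=> z1; have := nm_le_sub 1 (1 + h.[z] * v z).
  rewrite nm1 opprD addNKr nmN nmM.
  have := inner_le1 vN z1; have := hk z z1; have := nm_ge0 h.[z].
  have := nm_ge0 (v z).
  by move: (nm (v z)) (nm h.[z]) => a b; nra.
split=> //.
have [c [P [Q [[c1 PQ] Q0 vE]]]] := inner_frac vN.
have nz z : nm z <= 1 -> (Q + h * P).[z] != 0.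
  move=> z1; have -> : (Q + h * P).[z] = Q.[z] * (1 + h.[z] * v z).
    by rewrite hornerD hornerM vE //; field; rewrite Q0.
  by rewrite mulf_neq0 ?Q0 // -nm_gt0 (lt_le_trans _ (den z z1)) // subr_gt0.
(* With $v = P/Q$, clearing $Q$ turns the Möbius quotient into $(gQ+z^dP)/(Q+hP)$. Reflection
   exchanges the two, since $P$ reflects $Q$ and $h$ reflects $g$. *)
have rf : reflected (N + d) c (g * Q + 'X^d * P) (Q + h * P).
  split=> // z z1; have zn0 := unit_neq0 z1; have c0 := unit_neq0 c1.
  rewrite !hornerD !hornerM hornerXn hE // rmorphD !rmorphM /= rmorphXn /=.
  have -> : conjc P.[z] = c^-1 * z ^- N * Q.[z].
    by rewrite PQ // !rmorphM /= rmorphXn /= (conj_unit c1) (conj_unit z1) conjcK exprVn.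
  rewrite conjcK PQ // exprD (conj_unit z1) exprVn; field.
  by rewrite !expf_neq0 ?c0.
have [e [s [e1 sN s1 BE]]] := inner_of_reflected rf nz.
exists e, s; split=> // z z1; rewrite -BE //.
rewrite !hornerD !hornerM hornerXn vE //.
have := nz z z1; rewrite hornerD hornerM => nz1.
have := den z z1; rewrite vE // => den1; field.
rewrite nz1 Q0 //= andbT.
Qed.

End InnerFunctions.

(** * An inner function close to $1/z$ on finitely many short arcs *)

Section Peaking.
Set Implicit Arguments.
Unset Strict Implicit.
Context {R : realType}.
Local Notation C := R[i].

Lemma sin_half_gt0 (t : R) : 0 < t -> t < 2 * pi -> 0 < sin (t / 2).
Proof. by move=> t0 t1; apply: sin_gt0_pi; apply/andP; split; lra. Qed.

Lemma sin_half_ge0 (t : R) : 0 <= t -> t < 2 * pi -> 0 <= sin (t / 2).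
Proof. by move=> t0 t1; apply: sin_ge0_pi; apply/andP; split; lra. Qed.

Lemma sin_halfN (a b : R) : sin ((a - b) / 2) = - sin ((b - a) / 2).
Proof. by rewrite -sinN; congr sin; lra. Qed.

(** $w \mapsto 1/(1-w)$ sends the closed disc without 1 into the right half-plane. *)
Lemma Re_inv_1B_gt0 (w : C) : nm w <= 1 -> w != 1 -> 0 < complex.Re (1 - w)^-1.
Proof.
move=> w1 wn1.
have d0 : 0 < nm (1 - w) ^+ 2 by rewrite exprn_gt0 // nm_gt0 subr_eq0 eq_sym.
have w21 : nm w ^+ 2 <= 1 by rewrite exprn_ile1 ?nm_ge0.
rewrite !nm_sq in d0 w21; case: w {w1 wn1} d0 w21 => a b /=.
rewrite sub0r sqrrN => d0 w21.
by rewrite divr_gt0 //; nra.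
Qed.

Lemma expi_chord_neq0 (a b : R) : a != b -> `|a - b| < 2 * pi ->
  expi a - expi b != 0.
Proof.
rewrite -nm_gt0 nm_chord => ab; rewrite ltr_norml => /andP[h1 h2].
rewrite mulr_gt0 // normr_gt0.
have [h|h] := ltP 0 (a - b); first by rewrite gt_eqF // sin_half_gt0.
by rewrite sin_halfN oppr_eq0 gt_eqF // sin_half_gt0; lra.
Qed.

Section Arcs.
Variables (n : nat) (x y : 'I_n.+1 -> R).
Hypothesis lt_xy : forall i, x i < y i.
Hypothesis disj : forall i j, i != j -> y i < x j \/ y j < x i.
(** The arcs fit in a window shorter than a full turn: half differences of end points stay in
    $(-\pi,\pi)$, where the sine has the sign of the angle. *)
Hypothesis span : forall i j, y i - x j < 2 * pi.

Let A : {poly C} := \prod_i ('X - (expi (y i))%:P).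
Let D : {poly C} := \prod_i ('X - (expi (x i))%:P).
Let L : R := \sum_i (y i - x i).
Let P := A - expi L *: D.
Let Q := A - D.

Let AE z : A.[z] = \prod_i (z - expi (y i)).
Proof. by rewrite horner_prod; apply: eq_bigr => i _; rewrite hornerXsubC. Qed.

Let DE z : D.[z] = \prod_i (z - expi (x i)).
Proof. by rewrite horner_prod; apply: eq_bigr => i _; rewrite hornerXsubC. Qed.

Let expiL : expi L = (\prod_i expi (y i)) / \prod_i expi (x i).
Proof.
rewrite expi_sum -prodfV -big_split /=; apply: eq_bigr => i _.
by rewrite expiB.
Qed.

Let prod_expi_neq0 (t : 'I_n.+1 -> R) : \prod_i expi (t i) != 0.
Proof. by apply/prodf_neq0 => i _; exact: expi_neq0. Qed.

Let conj_prod z (t : 'I_n.+1 -> R) : nm z = 1 ->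
  z ^+ n.+1 * conjc (\prod_i (z - expi (t i))) =
  (-1) ^+ n.+1 / (\prod_i expi (t i)) * \prod_i (z - expi (t i)).
Proof.
move=> z1; rewrite rmorph_prod /=.
have cn (c : C) : c ^+ n.+1 = \prod_(i < n.+1) c by rewrite prodr_const card_ord.
rewrite !cn -prodfV -!big_split /=; apply: eq_bigr => i _.
rewrite conjcB expi_conj expiN (conj_unit z1); field.
by rewrite expi_neq0 unit_neq0.
Qed.

(** Reflection multiplies $A$ and $D$ by constants whose quotient is $e^{iL}$ up to inversion; this
    is the origin of the coefficient of $D$ in [P]. *)
Let reflPQ : reflected n.+1 ((-1) ^+ n.+1 * \prod_i expi (y i)) P Q.
Proof.
split=> [|z z1].
  rewrite nmM nmX nmN nm1 expr1n mul1r nm_prod big1 // => i _.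
  exact: nm_expi.
rewrite !hornerE AE DE conjcB -mulrA mulrBr !conj_prod // expiL.
have := prod_expi_neq0 x; have := prod_expi_neq0 y.
set a := \prod_i expi (y i); set b := \prod_i expi (x i) => a0 b0.
set e := (-1) ^+ n.+1; have ee : e * e = 1 by rewrite -expr2 sqrr_sign.
set u := \prod_i _; set v := \prod_i _; rewrite -[LHS]mul1r -ee; field.
by rewrite a0 b0.
Qed.

Let xxn i j : i != j -> expi (x i) - expi (x j) != 0.
Proof.
move=> ij; have := lt_xy i; have := lt_xy j; have := span i j; have := span j i.
move=> h1 h2 h3 h4; apply: expi_chord_neq0.
  by apply/eqP => e; have [] := disj ij; lra.
by rewrite ltr_norml; apply/andP; split; lra.
Qed.

Let xyn i j : expi (x i) - expi (y j) != 0.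
Proof.
have := lt_xy i; have := lt_xy j; have := span i j; have := span j i.
move=> h1 h2 h3 h4; apply: expi_chord_neq0.
  apply/eqP => e; have [ij|ij] := eqVneq i j; first by move: e h4; rewrite ij; lra.
  by have [] := disj ij; lra.
by rewrite ltr_norml; apply/andP; split; lra.
Qed.

Let r i k : R := sin ((x i - y k) / 2) / sin ((x i - x k) / 2).

(** By disjointness both ends of arc [k] lie on the same side of [x i], so the two sines have the
    same sign. *)
Let r_gt0 i k : i != k -> 0 < r i k.
Proof.
move=> ik; have := lt_xy i; have := lt_xy k; have := span i k; have := span k i.
move=> h1 h2 h3 h4; rewrite /r.
have [h|h] := disj ik; last by rewrite divr_gt0 // sin_half_gt0; lra.
rewrite sin_halfN (sin_halfN (x i)) invrN mulrNN.
by rewrite divr_gt0 // sin_half_gt0; lra.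
Qed.

Let ratioE i k : i != k ->
  (expi (x i) - expi (y k)) / (expi (x i) - expi (x k)) =
  (r i k)%:C%C * expi ((y k - x k) / 2).
Proof.
move=> ik; have := xxn ik; rewrite !expi_chord => h.
have s0 : (sin ((x i - x k) / 2))%:C%C != 0 :> C.
  by apply: contraNneq h => ->; rewrite mulr0 mul0r.
have -> : (x i + y k) / 2 = (x i + x k) / 2 + (y k - x k) / 2 by field.
rewrite /r rmorphM /= fmorphV /= expiD.
have i0 : 'i%C != 0 :> C by rewrite unit_neq0 ?nm_i.
by field; rewrite s0 i0 expi_neq0.
Qed.

Let p i : R := sin ((y i - x i) / 2) * \prod_(k | k != i) r i k.

Let p_gt0 i : 0 < p i.
Proof.
rewrite mulr_gt0 ?prodr_gt0 // => [|k ki]; last by rewrite r_gt0 // eq_sym.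
by apply: sin_half_gt0; [rewrite subr_gt0 | exact: span].
Qed.

(** The residue of $Q/D$ at $e^{ix_i}$, where $Q = A$. *)
Let alpha i := \prod_k (expi (x i) - expi (y k)) /
  \prod_(k | k != i) (expi (x i) - expi (x k)).

(** Up to a positive factor the residue is $-2i\,e^{iL/2}e^{ix_i}$: the phases of the chord
    quotients add up to half the total length, whatever [i]. *)
Let alphaE i :
  alpha i = - (2 * 'i%C * expi (L / 2) * expi (x i)) * (p i)%:C%C.
Proof.
have -> : alpha i = (expi (x i) - expi (y i)) * \prod_(k | k != i)
    ((expi (x i) - expi (y k)) / (expi (x i) - expi (x k))).
  by rewrite /alpha (bigD1 i) //= big_split prodfV mulrA.
rewrite (eq_bigr (fun k => (r i k)%:C%C * expi ((y k - x k) / 2))); last first.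
  by move=> k ki; rewrite ratioE 1?eq_sym.
rewrite big_split /= expi_chord rmorphM /= rmorph_prod /=.
have -> : expi (L / 2) =
    expi ((y i - x i) / 2) * \prod_(k | k != i) expi ((y k - x k) / 2).
  rewrite -(expi_sum _ (fun k => k != i)) -expiD; congr expi.
  by rewrite /L mulr_suml (bigD1 i).
rewrite sin_halfN rmorphN /=.
have -> : (x i + y i) / 2 = x i + (y i - x i) / 2 by field.
by rewrite expiD; ring.
Qed.

Let sizeM (t : 'I_n.+1 -> R) : size (\prod_i ('X - (expi (t i))%:P) : {poly C}) = n.+2.
Proof. by rewrite size_prod_XsubC /index_enum -enumT size_enum_ord. Qed.

Let coefM (t : 'I_n.+1 -> R) : (\prod_i ('X - (expi (t i))%:P) : {poly C})`_n.+1 = 1.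
Proof.
have /monicP := monic_prod_XsubC (index_enum 'I_n.+1) predT (fun i => expi (t i)).
by rewrite /lead_coef sizeM.
Qed.

(** Lagrange interpolation at the left end points: the leading terms of the monic $A$ and $D$
    cancel, so [n.+1] nodes determine $Q$. *)
Let QE : Q = \sum_i alpha i *: \prod_(k | k != i) ('X - (expi (x k))%:P).
Proof.
apply/eqP; rewrite -subr_eq0; apply: contraT.
set E := _ - _ => E0.
have sE : (size E <= n.+1)%N.
  apply: leq_trans (size_polyD _ _) _; rewrite geq_max; apply/andP; split.
    apply/leq_sizeP => j; rewrite leq_eqVlt => /predU1P[<-|nj].
      by rewrite coefB !coefM subrr.
    by rewrite coefB !nth_default ?subrr // sizeM.
  rewrite size_polyN; apply: leq_trans (size_sum _ _ _) _.
  apply/bigmax_leqP => i _; apply: leq_trans (size_scale_leq _ _) _.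
  have := sizeM x; rewrite (bigD1 i) //= size_monicM ?monicXsubC //; last first.
    exact/monic_neq0/(monic_prod_XsubC _ (fun k => k != i)).
  by rewrite size_XsubC /= add1n => -[/eq_leq].
pose rs := [seq expi (x i) | i <- enum 'I_n.+1].
have : (size rs < size E)%N; last first.
  by rewrite size_map size_enum_ord ltnNge sE.
apply: max_poly_roots => //; last first.
  rewrite map_inj_uniq ?enum_uniq // => i j xij; apply/eqP; apply: contraT.
  by move=> /xxn; rewrite xij subrr eqxx.
apply/allP => _ /mapP[i _ ->]; apply/rootP.
have hs : (\sum_j alpha j *: \prod_(k | k != j) ('X - (expi (x k))%:P)).[expi (x i)] =
    \prod_k (expi (x i) - expi (y k)).
  rewrite horner_sum (bigD1 i) //= [X in _ + X]big1 => [|k ki]; last first.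
    rewrite hornerZ horner_prod (bigD1 i) 1?eq_sym //= hornerXsubC subrr.
    by rewrite mul0r mulr0.
  rewrite addr0 hornerZ horner_prod /alpha.
  rewrite [X in _ * X](eq_bigr (fun k => expi (x i) - expi (x k))); last first.
    by move=> k _; rewrite hornerXsubC.
  rewrite divfK //; apply/prodf_neq0 => k ki; rewrite xxn // eq_sym.
  exact: ki.
rewrite /E hornerD hornerN hs /Q hornerD hornerN AE DE.
by rewrite [X in _ - X - _](bigD1 i) //= subrr mul0r subr0 subrr.
Qed.

(* Q / D is a multiple of a sum of the functions zeta / (zeta - z), zeta the
   left end points, with positive coefficients. *)
Let Q_neq0 z : nm z <= 1 -> Q.[z] != 0.
Proof.
move=> z1; have [/existsP[i /eqP zi]|] := boolP [exists i, z == expi (x i)].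
  rewrite hornerD hornerN AE DE zi [X in _ - X](bigD1 i) //= subrr mul0r subr0.
  by apply/prodf_neq0 => k _; exact: xyn.
rewrite negb_exists => /forallP zx.
have D0 : D.[z] != 0 by rewrite DE; apply/prodf_neq0 => k _; rewrite subr_eq0.
have -> : Q.[z] = 2 * 'i%C * expi (L / 2) * D.[z] *
    \sum_i (p i)%:C%C * (1 - z / expi (x i))^-1.
  rewrite QE horner_sum mulr_sumr; apply: eq_bigr => i _.
  rewrite hornerZ horner_prod alphaE DE [in RHS](bigD1 i) //=.
  under eq_bigr => k _ do rewrite hornerXsubC.
  have h1 := expi_neq0 (x i); have h2 : z - expi (x i) != 0 by rewrite subr_eq0.
  by field; rewrite h1 -opprB oppr_eq0 h2.
have pos i : 0 < complex.Re ((p i)%:C%C * (1 - z / expi (x i))^-1).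
  have := @Re_inv_1B_gt0 (z / expi (x i)).
  rewrite nm_div nm_expi divr1 z1 => /(_ isT).
  rewrite -[X in _ != X](divff (expi_neq0 (x i))) (inj_eq (divIf (expi_neq0 _))).
  move=> /(_ (zx i)); case: (_^-1) => a b /= a0.
  by rewrite mul0r subr0 mulr_gt0 ?p_gt0.
rewrite !mulf_neq0 ?expi_neq0 //; first by rewrite unit_neq0 ?nm_i.
apply/eqP => /(congr1 (@complex.Re R)); apply/eqP; rewrite gt_eqF //=.
rewrite (@big_morph _ _ (@complex.Re R) 0 +%R) //; last by move=> [a b] [c d].
by rewrite (bigD1 ord0) //= ltr_wpDr // sumr_ge0 // => i _; apply/ltW.
Qed.

Let root_P0 : root P 0.
Proof.
apply/rootP; rewrite !hornerE AE DE expiL.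
have cn (c : 'I_n.+1 -> C) : \prod_i (0 - c i) = (-1) ^+ n.+1 * \prod_i c i.
  have -> : (-1) ^+ n.+1 = \prod_(i < n.+1) (-1) :> C.
    by rewrite prodr_const card_ord.
  rewrite -big_split /=.
  by apply: eq_bigr => i _; rewrite sub0r mulN1r.
rewrite !cn mulrCA divfK ?subrr //; exact: prod_expi_neq0.
Qed.

(** After removal of a common factor, $A$ and $D$ become $e^{iL/2}a$ and $d$ with $a$, $d$ real. On
    arc [i] only the [i]-th factors have opposite signs, so $ad \le 0$ and $|e^{iL/2}a-d|^2 = a^2 -
    2ad\cos(L/2) + d^2 \ge d^2$; $L \le \pi$ makes the cosine nonnegative. *)
Let D_le_Q i s : L <= pi -> x i <= s <= y i -> nm D.[expi s] <= nm Q.[expi s].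
Proof.
move=> Lpi /andP[xs sy]; rewrite hornerD hornerN AE DE.
pose a := \prod_k sin ((s - y k) / 2); pose d := \prod_k sin ((s - x k) / 2).
pose g : C := \prod_k (2 * 'i%C * expi ((s + x k) / 2)).
have -> : \prod_k (expi s - expi (x k)) = g * d%:C%C.
  rewrite /d rmorph_prod -big_split /=; apply: eq_bigr => k _.
  by rewrite expi_chord; ring.
have -> : \prod_k (expi s - expi (y k)) = g * (expi (L / 2) * a%:C%C).
  have -> : L / 2 = \sum_k ((y k - x k) / 2) by rewrite /L mulr_suml.
  rewrite expi_sum /a rmorph_prod -!big_split /=; apply: eq_bigr => k _.
  rewrite expi_chord.
  have -> : (s + y k) / 2 = (s + x k) / 2 + (y k - x k) / 2 by field.
  by rewrite expiD; ring.
rewrite -mulrBr !nmM ler_wpM2l ?nm_ge0 //.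
rewrite -(@ler_pXn2r _ 2) ?nnegrE ?nm_ge0 //.
have -> : nm d%:C%C ^+ 2 = d ^+ 2 by rewrite nm_real real_normK ?num_real.
have -> : nm (expi (L / 2) * a%:C%C - d%:C%C) ^+ 2 =
    a ^+ 2 * (cos (L / 2) ^+ 2 + sin (L / 2) ^+ 2)
    - 2 * (a * d * cos (L / 2)) + d ^+ 2 by rewrite nm_sq /=; ring.
have ad : a * d <= 0.
  rewrite /a /d -big_split (bigD1 i) //= mulr_le0_ge0 //.
    have := span i i => sp.
    rewrite sin_halfN mulNr oppr_le0 mulr_ge0 // sin_half_ge0; lra.
  apply: prodr_ge0 => k ki; have := lt_xy k.
  have := span i k; have := span k i => h1 h2 h3.
  have [h|h] := disj ki; first by rewrite mulr_ge0 // sin_half_ge0; lra.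
  rewrite sin_halfN (sin_halfN s) mulrNN.
  by rewrite mulr_ge0 // sin_half_ge0; lra.
have L0 : 0 <= L by apply: sumr_ge0 => k _; rewrite subr_ge0 ltW.
have c0 : 0 <= cos (L / 2) by apply: cos_ge0_pihalf; apply/andP; split; lra.
by have := mulr_le0_ge0 ad c0; rewrite cos2Dsin2; have := sqr_ge0 a; lra.
Qed.

(** Since $P(0)=0$, one can divide $P$ by $z$ and take $zv = P/Q$. Then $zv-1 = (1-e^{iL})D/Q$,
    where $|1-e^{iL}| \le L$ and $|D/Q| \le 1$ on the arcs. *)
Lemma peaking_arcs : L <= pi -> exists2 v, inner n v &
  forall i s, x i <= s <= y i -> nm (expi s * v (expi s) - 1) <= L.
Proof.
move=> Lpi; have /factor_theorem[q Pq] := root_P0.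
rewrite subr0 in Pq.
have rq : reflected n ((-1) ^+ n.+1 * \prod_i expi (y i)) q Q.
  have [c1 PQ] := reflPQ; split=> // z z1; apply: (mulIf (unit_neq0 z1)).
  have := PQ z z1; rewrite Pq hornerM hornerX => ->.
  by rewrite [z ^+ _]exprSr !mulrA; set e := _ ^+ n.+1; ring.
exists (fun z => q.[z] / Q.[z]); first exact: inner_of_reflected rq Q_neq0.
move=> i s sxy; have Q0 := Q_neq0 (_ : nm (expi s) <= 1).
have {}Q0 : Q.[expi s] != 0 by apply: Q0; rewrite nm_expi.
have -> : expi s * (q.[expi s] / Q.[expi s]) - 1 =
    (1 - expi L) * D.[expi s] / Q.[expi s].
  have PE : P.[expi s] = expi s * q.[expi s] by rewrite Pq hornerM hornerX mulrC.
  rewrite mulrA -PE /P !hornerE; have : Q.[expi s] = A.[expi s] - D.[expi s].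
    by rewrite !hornerE.
  by move=> QE'; rewrite QE' in Q0 *; field.
have Qs : 0 < nm Q.[expi s] by rewrite nm_gt0.
rewrite nm_div nmM ler_pdivrMr //.
have L0 : 0 <= L by apply: sumr_ge0 => k _; rewrite subr_ge0 ltW.
apply: ler_pM; rewrite ?nm_ge0 ?(@D_le_Q i) //.
by rewrite nmC -expi0 (le_trans (expi_lip _ _)) // subr0 ger0_norm.
Qed.

End Arcs.
End Peaking.

(** * Goursat's argument for trapezoid sums over polar rectangles *)

Section Goursat.
Set Implicit Arguments.
Unset Strict Implicit.
Context {R : realType}.
Local Notation C := R[i].
Implicit Types (g : C -> C) (z : C) (a b c d w h t r : R).

(** Complex differentiability with real radii and without division. *)
Definition cdiff g z := exists l : C, forall e : R, 0 < e ->
  exists2 d : R, 0 < d & forall z', nm (z' - z) < d ->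
    nm (g z' - g z - l * (z' - z)) <= e * nm (z' - z).

Definition trap g (z z' : C) : C := (g z + g z') / 2 * (z' - z).

Definition node a b n (j : nat) : R := a + (b - a) * (j%:R / n%:R).

(** A trapezoid sum standing for the integral of [g] along the path [p] from [a] to [b]. *)
Definition side g (p : R -> C) a b n : C :=
  \sum_(j < n) trap g (p (node a b n j)) (p (node a b n j.+1)).

Lemma node0 a b n : node a b n 0 = a.
Proof. by rewrite /node mul0r mulr0 addr0. Qed.

Lemma node_last a b n : (0 < n)%N -> node a b n n = b.
Proof.
by move=> n0; rewrite /node divff ?pnatr_eq0 -?lt0n // mulr1 addrC subrK.
Qed.

Lemma node_bound a b n j : a <= b -> (j <= n)%N -> (0 < n)%N ->
  a <= node a b n j <= b.
Proof.
move=> ab jn n0; have n0R : 0 < n%:R :> R by rewrite ltr0n.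
have h0 : 0 <= j%:R / n%:R :> R by rewrite divr_ge0.
have h1 : j%:R / n%:R <= 1 :> R by rewrite ler_pdivrMr // mul1r ler_nat.
by rewrite /node; apply/andP; split; nra.
Qed.

Lemma side_split g p a b n : (0 < n)%N ->
  side g p a b (n + n) = side g p a ((a + b) / 2) n + side g p ((a + b) / 2) b n.
Proof.
move=> n0; have nR : n%:R != 0 :> R by rewrite pnatr_eq0 -lt0n.
have nnR : n%:R + n%:R != 0 :> R by rewrite -natrD pnatr_eq0 -lt0n addn_gt0 n0.
rewrite /side big_split_ord /=; congr (_ + _); apply: eq_bigr => j _.
  by congr trap; congr p; rewrite /node natrD; field; rewrite nR.
by congr trap; congr p; rewrite /node -?addnS !natrD; field; rewrite nR.
Qed.

(* The trapezoid rule along a polygonal line is exact for affine functions. *)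
Lemma side_affine_approx g p a b n (l m : C) (K e : R) : a <= b -> (0 < n)%N ->
  (forall s t, a <= s -> s <= t -> t <= b -> nm (p t - p s) <= K * (t - s)) ->
  (forall t, a <= t <= b -> nm (g (p t) - (l * p t + m)) <= e) ->
  nm (side g p a b n - ((l / 2 * p b ^+ 2 + m * p b) - (l / 2 * p a ^+ 2 + m * p a)))
    <= e * (K * (b - a)).
Proof.
move=> ab n0 pK ge.
pose F z := l / 2 * z ^+ 2 + m * z.
have e0 : 0 <= e by apply: le_trans (ge a _); rewrite ?nm_ge0 // lexx ab.
rewrite -[_ - (l / 2 * p a ^+ 2 + _)]/(F (p b) - F (p a)).
have -> : F (p b) - F (p a) =
    \sum_(j < n) (F (p (node a b n j.+1)) - F (p (node a b n j))).
  rewrite -(big_mkord predT (fun j => F (p (node a b n j.+1)) - F (p (node a b n j)))).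
  by rewrite telescope_sumr // node0 node_last.
have -> : K * (b - a) = \sum_(j < n) (K * (node a b n j.+1 - node a b n j)).
  rewrite -mulr_sumr; congr (_ * _).
  rewrite -(big_mkord predT (fun j => node a b n j.+1 - node a b n j)).
  by rewrite telescope_sumr // node0 node_last.
rewrite /side -sumrB mulr_sumr; apply: le_trans (nm_sum _ _ _) _.
apply: ler_sum => j _; have /andP[j1 j2] := node_bound ab (ltnW (ltn_ord j)) n0.
have /andP[j3 j4] := node_bound ab (ltn_ord j) n0.
have jj : node a b n j <= node a b n j.+1.
  rewrite /node lerD2l ler_wpM2l ?subr_ge0 // ler_pM2r ?invr_gt0 ?ltr0n //.
  by rewrite ler_nat.
have := pK _ _ j1 jj j4; have := ge (node a b n j).
have := ge (node a b n j.+1); rewrite j1 j2 j3 j4 => /(_ isT) + /(_ isT).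
set z := p (node a b n j); set z' := p (node a b n j.+1) => h' h hK.
have -> : trap g z z' - (F z' - F z) =
    (g z - (l * z + m) + (g z' - (l * z' + m))) / 2 * (z' - z).
  by rewrite /trap /F; field.
rewrite nmM nm_div nm_nat; apply: ler_pM; rewrite ?divr_ge0 ?nm_ge0 //.
by rewrite ler_pdivrMr //; apply: le_trans (nmD _ _) _; lra.
Qed.

Definition polar r t : C := r%:C%C * expi t.

Lemma nm_polar r t : 0 <= r -> nm (polar r t) = r.
Proof. by move=> r0; rewrite nmM nm_expi mulr1 nm_real ger0_norm. Qed.

Lemma polar_rad r r' t : r <= r' -> nm (polar r' t - polar r t) <= 1 * (r' - r).
Proof.
move=> rr; rewrite /polar -mulrBl -rmorphB nmM nm_expi nm_real mulr1 mul1r.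
by rewrite ger0_norm // subr_ge0.
Qed.

Lemma polar_ang r t t' : 0 <= r <= 1 -> t <= t' ->
  nm (polar r t' - polar r t) <= 1 * (t' - t).
Proof.
move=> /andP[r0 r1] tt; rewrite /polar -mulrBr nmM nm_real ger0_norm //.
by apply: ler_pM; rewrite ?nm_ge0 // (le_trans (expi_lip _ _)) // ger0_norm ?subr_ge0.
Qed.

(** The counterclockwise boundary of the polar rectangle with radii in $[a,a+w]$ and angles in
    $[c,c+h]$. *)
Definition cell g a w c h n : C :=
  side g (polar^~ c) a (a + w) n + side g (polar (a + w)) c (c + h) n
  - side g (polar^~ (c + h)) a (a + w) n - side g (polar a) c (c + h) n.

(** The quarters share their nodes on inner sides, so these sides cancel exactly; the outer sides
    have twice as many steps. *)
Lemma cell_split g a w c h n : (0 < n)%N ->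
  cell g a w c h (n + n) =
    cell g a (w / 2) c (h / 2) n + cell g (a + w / 2) (w / 2) c (h / 2) n
  + cell g a (w / 2) (c + h / 2) (h / 2) n
  + cell g (a + w / 2) (w / 2) (c + h / 2) (h / 2) n.
Proof.
move=> n0; rewrite /cell.
have mid (x y : R) : (x + (x + y)) / 2 = x + y / 2 by field.
have half (x y : R) : x + y / 2 + y / 2 = x + y by field.
by rewrite !half !side_split // !mid; ring.
Qed.

(** The primitives of the affine part cancel around the boundary. What remains is the error times
    the perimeter, at most $2(w+h)$ because the radii do not exceed 1. *)
Lemma cell_affine_approx g a w c h n (l m : C) (e : R) :
  0 <= a -> 0 <= w -> a + w <= 1 -> 0 <= h -> (0 < n)%N ->
  (forall r t, a <= r <= a + w -> c <= t <= c + h ->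
    nm (g (polar r t) - (l * polar r t + m)) <= e) ->
  nm (cell g a w c h n) <= 2 * e * (w + h).
Proof.
move=> a0 w0 aw1 h0 n0 ge.
have aw : a <= a + w by rewrite lerDl.
have ch : c <= c + h by rewrite lerDl.
have rad t : c <= t <= c + h ->
    forall s u, a <= s -> s <= u -> u <= a + w -> nm (polar u t - polar s t) <= 1 * (u - s).
  by move=> _ s u _ su _; exact: polar_rad.
have ang r : a <= r <= a + w ->
    forall s u, c <= s -> s <= u -> u <= c + h -> nm (polar r u - polar r s) <= 1 * (u - s).
  by move=> /andP[ar rw] s u _ su _; apply: polar_ang => //; apply/andP; split; lra.
have ra : a <= a <= a + w by rewrite lexx.
have rw : a <= a + w <= a + w by rewrite lexx aw.
have tc : c <= c <= c + h by rewrite lexx.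
have th : c <= c + h <= c + h by rewrite lexx ch.
have := @side_affine_approx g (polar^~ c) _ _ n l m 1 e aw n0 (rad _ tc)
  (fun r hr => ge r c hr tc).
have := @side_affine_approx g (polar^~ (c + h)) _ _ n l m 1 e aw n0 (rad _ th)
  (fun r hr => ge r _ hr th).
have := @side_affine_approx g (polar a) _ _ n l m 1 e ch n0 (ang _ ra)
  (fun t ht => ge a t ra ht).
have := @side_affine_approx g (polar (a + w)) _ _ n l m 1 e ch n0 (ang _ rw)
  (fun t ht => ge _ t rw ht).
rewrite /cell !mul1r (addrC a w) (addrC c h) !addrK (addrC w a) (addrC h c).
set s1 := side _ _ _ _ _; set F1 := (X in s1 - X).
set s2 := side _ _ _ _ _; set F2 := (X in s2 - X).
set s3 := side _ _ _ _ _; set F3 := (X in s3 - X).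
set s4 := side _ _ _ _ _; set F4 := (X in s4 - X) => k1 k2 k3 k4.
have -> : s4 + s1 - s3 - s2 = (s4 - F4) + (s1 - F1) - (s3 - F3) - (s2 - F2).
  by rewrite /F1 /F2 /F3 /F4; ring.
have := nmB (s4 - F4 + (s1 - F1) - (s3 - F3)) (s2 - F2).
have := nmB (s4 - F4 + (s1 - F1)) (s3 - F3).
have := nmD (s4 - F4) (s1 - F1).
lra.
Qed.

Lemma cell_differentiable_bound g a w c h n r t (l : C) (k d : R) :
  0 <= a -> 0 <= w -> a + w <= 1 -> 0 <= h -> (0 < n)%N ->
  a <= r <= a + w -> c <= t <= c + h -> w + h < d -> 0 <= k ->
  (forall z', nm (z' - polar r t) < d ->
    nm (g z' - g (polar r t) - l * (z' - polar r t)) <= k * nm (z' - polar r t)) ->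
  nm (cell g a w c h n) <= 2 * (k * (w + h)) * (w + h).
Proof.
move=> a0 w0 aw1 h0 n0 /andP[r1 r2] /andP[t1 t2] whd k0 gd.
apply: (@cell_affine_approx _ _ _ _ _ _ l (g (polar r t) - l * polar r t)) => //.
move=> r' t' /andP[r'1 r'2] /andP[t'1 t'2].
have lipr (x y s : R) : nm (polar x s - polar y s) <= `|x - y|.
  by rewrite /polar -mulrBl -rmorphB nmM nm_expi nm_real mulr1.
have lipt (x y : R) : nm (polar r x - polar r y) <= `|x - y|.
  rewrite /polar -mulrBr nmM nm_real -[leRHS]mul1r.
  by apply: ler_pM; rewrite ?nm_ge0 ?expi_lip // ger0_norm; lra.
have near : nm (polar r' t' - polar r t) <= w + h.
  apply: le_trans (nm_tri _ (polar r t') _) _; apply: lerD.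
    by apply: le_trans (lipr _ _ _) _; rewrite ler_norml; apply/andP; split; lra.
  by apply: le_trans (lipt _ _) _; rewrite ler_norml; apply/andP; split; lra.
have := gd (polar r' t') (le_lt_trans near whd).
rewrite [X in nm X <= _](_ : _ = g (polar r' t') -
  (l * polar r' t' + (g (polar r t) - l * polar r t))); last by ring.
by move=> /le_trans; apply; rewrite ler_wpM2l.
Qed.

Lemma nested_point (a w : nat -> R) : (forall n, 0 <= w n) ->
  (forall n, a n <= a n.+1) -> (forall n, a n.+1 + w n.+1 <= a n + w n) ->
  exists x, forall n, a n <= x <= a n + w n.
Proof.
move=> w0 ua ub.
have mono n k : a n <= a (n + k)%N.
  by elim: k => [|k]; rewrite ?addn0 // addnS => /le_trans; apply.
have anti n k : a (n + k)%N + w (n + k)%N <= a n + w n.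
  by elim: k => [|k]; rewrite ?addn0 // addnS; apply: le_trans.
have ab n k : a n <= a k + w k.
  apply: le_trans (mono n k) _; rewrite addnC.
  by apply: le_trans (anti k n); rewrite lerDl.
have ne : range a !=set0 by exists (a 0%N), 0%N.
have bd : has_ubound (range a) by exists (a 0%N + w 0%N) => _ [n _ <-].
exists (sup (range a)) => n; apply/andP; split.
  by apply: ub_le_sup => //; exists n.
by apply: ge_sup => // _ [k _ <-].
Qed.

(** The sum exceeds [e] for arbitrarily fine subdivisions. As no limit is known to exist, this
    replaces a lower bound on the contour integral. *)
Definition bad g a w c h (e : R) :=
  forall N, exists2 m, (N <= m)%N & e < nm (cell g a w c h (2 ^ m)).

Lemma not_bad g a w c h (e : R) : ~ bad g a w c h e ->
  exists N, forall m, (N <= m)%N -> nm (cell g a w c h (2 ^ m)) <= e.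
Proof.
move=> nb; apply: contrapT => nN; apply: nb => N; apply: contrapT => nm'.
apply: nN; exists N => m Nm; rewrite leNgt; apply/negP => lt_e.
by apply: nm'; exists m.
Qed.

Lemma bad_quarter g a w c h (e : R) : bad g a w c h e ->
  exists i j : bool, bad g (a + i%:R * (w / 2)) (w / 2) (c + j%:R * (h / 2)) (h / 2) (e / 4).
Proof.
move=> be; apply: contrapT => nb.
have ev (i j : bool) : exists N, forall m, (N <= m)%N ->
    nm (cell g (a + i%:R * (w / 2)) (w / 2) (c + j%:R * (h / 2)) (h / 2) (2 ^ m)) <= e / 4.
  by apply: not_bad => b; apply: nb; exists i, j.
have [N1 h1] := ev false false; have [N2 h2] := ev true false.
have [N3 h3] := ev false true; have [N4 h4] := ev true true.
(* The successor forces a positive exponent, so that the subdivision can be halved. *)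
have [[//|m]] := be (N1 + N2 + N3 + N4).+1; rewrite ltnS => mN.
have := h1 m; have := h2 m; have := h3 m; have := h4 m.
rewrite !mul0r !mul1r !addr0 => k4 k3 k2 k1.
apply/negP; rewrite -leNgt expnS mul2n -addnn cell_split ?expn_gt0 //.
have {}k1 := k1 (_ : (N1 <= m)%N); have {}k2 := k2 (_ : (N2 <= m)%N).
have {}k3 := k3 (_ : (N3 <= m)%N); have {}k4 := k4 (_ : (N4 <= m)%N).
have {k1}k1 := k1 ltac:(lia); have {k2}k2 := k2 ltac:(lia).
have {k3}k3 := k3 ltac:(lia); have {k4}k4 := k4 ltac:(lia).
set u1 := cell _ _ _ _ _ _ in k1 *; set u2 := cell _ _ _ _ _ _ in k2 *.
set u3 := cell _ _ _ _ _ _ in k3 *; set u4 := cell _ _ _ _ _ _ in k4 *.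
have := nmD (u1 + u2 + u3) u4; have := nmD (u1 + u2) u3; have := nmD u1 u2.
lra.
Qed.

(** Otherwise bad quarters nest down to a point, where differentiability makes the sums over the
    [n]-th cell at most $e/(2\cdot 4^n)$, against the bound $e/4^n$ that badness requires them to
    exceed. *)
Lemma goursat_cell g a w c h : 0 <= a -> 0 < w -> a + w <= 1 -> 0 < h ->
  (forall r t, a <= r <= a + w -> c <= t <= c + h -> cdiff g (polar r t)) ->
  forall e, 0 < e -> exists N, forall m, (N <= m)%N ->
    nm (cell g a w c h (2 ^ m)) <= e.
Proof.
move=> a0 w0 aw1 h0 gd e e0; apply: not_bad => be.
pose W n := w / 2 ^+ n; pose H n := h / 2 ^+ n.
pose B n (p : R * R) := bad g p.1 (W n) p.2 (H n) (e / 4 ^+ n).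
have W2 n : W n / 2 = W n.+1 by rewrite /W exprSr invfM mulrA.
have H2 n : H n / 2 = H n.+1 by rewrite /H exprSr invfM mulrA.
have W0 n : 0 < W n by rewrite divr_gt0 ?exprn_gt0.
have H0 n : 0 < H n by rewrite divr_gt0 ?exprn_gt0.
(* The badness hypothesis is placed under the existential so that [choice] gives a total successor;
   [(0, 0)] is a default. *)
have step (np : nat * (R * R)) : exists p', B np.1 np.2 ->
    [/\ B np.1.+1 p', np.2.1 <= p'.1 <= np.2.1 + W np.1.+1
      & np.2.2 <= p'.2 <= np.2.2 + H np.1.+1].
  case: np => n [x y] /=; have [Bn|nB] := pselect (B n (x, y)); last by exists (0, 0).
  have [i [j]] := bad_quarter Bn; rewrite W2 H2 => bq.
  exists (x + i%:R * W n.+1, y + j%:R * H n.+1) => _ /=.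
  have := W0 n.+1; have := H0 n.+1; split; rewrite /B /=.
  - have <- : e / 4 ^+ n / 4 = e / 4 ^+ n.+1 by rewrite exprSr invfM mulrA.
    exact: bq.
  - by case: (i); rewrite ?mul1r ?mul0r ?addr0 ?lexx; apply/andP; split; lra.
  - by case: (j); rewrite ?mul1r ?mul0r ?addr0 ?lexx; apply/andP; split; lra.
have [F FP] := choice step.
pose p := fix p n := if n is n'.+1 then F (n', p n') else (a, c).
have pB n : B n (p n).
  elim: n => [|n IHn]; first by rewrite /B /W /H !expr0 !divr1.
  by have [] := FP (n, p n) IHn.
have pS n : [/\ (p n).1 <= (p n.+1).1 <= (p n).1 + W n.+1
    & (p n).2 <= (p n.+1).2 <= (p n).2 + H n.+1].
  by have [] := FP (n, p n) (pB n).
have WW n : W n = W n.+1 + W n.+1 by rewrite -W2; field.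
have HH n : H n = H n.+1 + H n.+1 by rewrite -H2; field.
have [r rP] : exists r, forall n, (p n).1 <= r <= (p n).1 + W n.
  apply: nested_point => n; first exact/ltW.
    by have [/andP[]] := pS n.
  by have [/andP[_ hx] _] := pS n; rewrite (WW n); lra.
have [t tP] : exists t, forall n, (p n).2 <= t <= (p n).2 + H n.
  apply: nested_point => n; first exact/ltW.
    by have [_ /andP[]] := pS n.
  by have [_ /andP[_ hx]] := pS n; rewrite (HH n); lra.
have pin n : a <= (p n).1 /\ (p n).1 + W n <= a + w.
  elim: n => [|n [h1 h2]]; first by rewrite /W expr0 divr1.
  by have [/andP[h3 h4] _] := pS n; move: h2; rewrite (WW n); lra.
have := rP 0%N; have := tP 0%N; rewrite /W /H expr0 !divr1 /= => t0 r0.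
(* The slope error is such that $2k((w+h)/2^n)^2 = e/(2\cdot 4^n)$. *)
have [l /(_ (e / (4 * (w + h) ^+ 2)))] := gd r t r0 t0.
have wh : 0 < (w + h) by lra.
have wh2 : 0 < 4 * (w + h) ^+ 2 by rewrite mulr_gt0 ?exprn_gt0.
rewrite divr_gt0 // => /(_ isT) [d d0 dP].
have [n nd] : exists n, (w + h) / 2 ^+ n < d.
  exists (Num.truncn ((w + h) / d)).+1.
  rewrite ltr_pdivrMr ?exprn_gt0 // mulrC -ltr_pdivrMr //.
  apply: lt_trans (truncnS_gt _) _.
  by rewrite -natrX ltr_nat ltn_expl.
have [m _] := pB n 0%N; apply/negP; rewrite -leNgt.
have [n1 n2] := pin n.
have whn : W n + H n = (w + h) / 2 ^+ n by rewrite /W /H -mulrDl.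
have an0 : 0 <= (p n).1 by apply: le_trans a0 n1.
have aw : (p n).1 + W n <= 1 by apply: le_trans n2 aw1.
have whd : W n + H n < d by rewrite whn.
have k0 : 0 <= e / (4 * (w + h) ^+ 2) by rewrite divr_ge0 // ltW.
have := @cell_differentiable_bound g (p n).1 (W n) (p n).2 (H n) (2 ^ m) r t l _ d
  an0 (ltW (W0 n)) aw (ltW (H0 n)) (expn_gt0 2 m) (rP n) (tP n) whd k0 dP.
move=> /le_trans; apply; rewrite whn.
have -> : 2 * (e / (4 * (w + h) ^+ 2) * ((w + h) / 2 ^+ n)) * ((w + h) / 2 ^+ n) =
    e / 4 ^+ n / 2.
  have -> : 4 ^+ n = 2 ^+ n * 2 ^+ n :> R by rewrite -exprMn -natrM.
  by field; rewrite expf_neq0 // gt_eqF.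
by rewrite ler_pdivrMr // ler_peMr ?ler1n // divr_ge0 ?exprn_ge0 // ltW.
Qed.

Lemma sin_ge_cos1 (x : R) : 0 <= x <= 1 -> x * cos 1 <= sin x.
Proof.
move=> /andP[x0 x1].
have fc : {within `[0, x], continuous (@sin R)}.
  by apply: continuous_subspaceT => y; exact: continuous_sin.
have [y] := MVT_segment x0 (fun y _ => is_derive_sin y) fc.
rewrite in_itv /= sin0 !subr0 => /andP[y0 yx] ->; rewrite mulrC ler_wpM2r //.
have p2 := pi_ge2 R.
rewrite leNgt ltr_cos ?in_itv /=; first by rewrite -leNgt; lra.
  by apply/andP; split; lra.
by apply/andP; split; lra.
Qed.

(** A discrete $\frac{1}{2\pi i}\oint g\,dz$ on the circle of radius [r]. *)
Definition cmean g r (M : nat) : C :=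
  M%:R^-1 * \sum_(j < M) g (r%:C%C * unity_root M ^+ j) * (r%:C%C * unity_root M ^+ j).

(** Regrouping the trapezoids by node gives $g(z_j)(z_{j+1}-z_{j-1})/2$, and $z_{j+1}-z_{j-1} =
    2i\sin(2\pi/M)z_j$: the identity is exact. *)
Lemma side_circle g r M : (0 < M)%N ->
  side g (polar r) 0 (2 * pi) M = 'i%C * (M%:R * sin (2 * pi / M%:R))%:C%C * cmean g r M.
Proof.
move=> M0; have MR : M%:R != 0 :> R by rewrite pnatr_eq0 -lt0n.
have MC : M%:R != 0 :> C by rewrite pnatr_eq0 -lt0n.
set W : C := unity_root M; pose z j := r%:C%C * W ^+ j.
have pz j : polar r (node 0 (2 * pi) M j) = z j.
  by rewrite /polar /z /W unity_rootX /node subr0 add0r mulrA.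
have W0 : W != 0 := unity_neq0 M.
have WW : W - W^-1 = 2 * 'i%C * (sin (2 * pi / M%:R))%:C%C.
  rewrite /W /unity_root -expiN expi_chord subrr mul0r expi0 mulr1.
  by congr (_ * (sin _)%:C%C); field.
rewrite /side; under eq_bigr => j _ do rewrite !pz.
pose f j := g (z j) * (z j - z j / W) / 2.
have -> : \sum_(j < M) trap g (z j) (z j.+1) =
    \sum_(j < M) (g (z j) * (z j.+1 - z j) / 2 + f j.+1).
  apply: eq_bigr => j _; rewrite /trap /f.
  have -> : z j.+1 / W = z j by rewrite /z exprSr mulrA mulfK.
  by field.
have fM : f M = f 0%N by rewrite /f /z /W unity_root1 // expr0.
rewrite big_split /=.
have -> : \sum_(j < M) f j.+1 = \sum_(j < M) f j.
  case: (M) M0 fM => // k _ fk; rewrite big_ord_recr big_ord_recl /= fk addrC.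
  by [].
rewrite -big_split /cmean mulrA -[_ * _ * M%:R^-1]mulrA mulr_sumr /=.
apply: eq_bigr => j _; rewrite /f -/W -/(z j).
have -> : z j.+1 = z j * W by rewrite /z exprSr mulrA.
rewrite rmorphM rmorph_nat /=.
transitivity (g (z j) * z j * (W - W^-1) / 2); first by ring.
by rewrite WW; field.
Qed.

(** The annulus cut along angle 0 is a single cell whose two radial sides coincide and cancel. *)
Lemma cmean_cvg g r1 r2 : 0 < r1 -> r1 < r2 -> r2 < 1 ->
  (forall z, 0 < nm z < 1 -> cdiff g z) ->
  forall e, 0 < e -> exists N, forall m, (N <= m)%N ->
    nm (cmean g r2 (2 ^ m) - cmean g r1 (2 ^ m)) <= e.
Proof.
move=> r10 r12 r21 gd e e0.
have pi0 := pi_gt0 R; have c1 := @cos1_gt0 R; have pi2 := @pihalf_lt2 R.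
have e1 : 0 < e * (2 * pi * cos 1) by rewrite !mulr_gt0.
have cd r t : r1 <= r <= r1 + (r2 - r1) -> 0 <= t <= 0 + 2 * pi -> cdiff g (polar r t).
  move=> /andP[h1 h2] _; apply: gd; rewrite nm_polar; last by lra.
  by apply/andP; split; lra.
have w0 : 0 < r2 - r1 by lra.
have w1 : r1 + (r2 - r1) <= 1 by lra.
have h0 : 0 < 2 * pi :> R by lra.
have [N NP] := goursat_cell (ltW r10) w0 w1 h0 cd e1.
(* At least 8 nodes make $2\pi/M \le 1$, so that [sin_ge_cos1] bounds $M\sin(2\pi/M)$ below
   independently of $M$. *)
exists (N + 3)%N => m Nm.
have {NP} := NP m (leq_trans (leq_addr _ _) Nm).
rewrite /cell addrCA subrr addr0 add0r.
have -> : polar^~ (2 * pi) = polar^~ (0 : R).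
  by apply/funext => r; rewrite /polar expi2pi expi0.
set M := (2 ^ m)%N; have M0 : (0 < M)%N by rewrite expn_gt0.
rewrite [_ + _ - side g (polar^~ 0) _ _ _]addrAC subrr add0r.
rewrite !side_circle // -mulrBr nmM nmM nm_i mul1r nm_real.
have MR : 0 < M%:R :> R by rewrite ltr0n.
have M8 : 8 <= M%:R :> R.
  by rewrite ler_nat -[8%N]/(2 ^ 3)%N leq_exp2l // (leq_trans _ Nm) // leq_addl.
have sM : 2 * pi * cos 1 <= M%:R * sin (2 * pi / M%:R) :> R.
  have -> : 2 * pi * cos 1 = M%:R * (2 * pi / M%:R * cos 1) :> R by field; rewrite gt_eqF.
  rewrite ler_wpM2l ?ler0n // sin_ge_cos1 //; apply/andP; split.
    by apply: divr_ge0; lra.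
  by rewrite ler_pdivrMr // mul1r; lra.
rewrite ger0_norm; last by apply: le_trans sM; rewrite !mulr_ge0 // ltW.
set x := nm _ => hx.
have x0 : 0 <= x by exact: nm_ge0.
rewrite leNgt; apply/negP => ex; move: hx; apply/negP; rewrite -ltNge.
have cc : 0 < 2 * pi * cos 1 :> R by rewrite !mulr_gt0.
by move: (2 * pi * cos 1) (M%:R * _) cc sM => u v; nra.
Qed.

End Goursat.

(** * Discrete Fejér means over roots of unity *)

Section Fejer.
Set Implicit Arguments.
Unset Strict Implicit.
Context {R : realType}.
Local Notation C := R[i].
Implicit Types (z b : C) (g : nat -> C).

Lemma expf_sub (x : C) k l : x != 0 -> (l <= k)%N -> x ^+ k / x ^+ l = x ^+ (k - l).
Proof. by move=> x0 lk; rewrite -{1}(subnK lk) exprD mulfK // expf_neq0. Qed.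

Definition fejer N z : R := N%:R^-1 * nm (\sum_(k < N) z ^+ k) ^+ 2.

Lemma fejer_ge0 N z : 0 <= fejer N z.
Proof. by rewrite mulr_ge0 ?exprn_ge0 ?nm_ge0. Qed.

Lemma fejerE N z : nm z = 1 ->
  (fejer N z)%:C%C = N%:R^-1 * \sum_(k < N) \sum_(l < N) z ^+ k * z ^- l.
Proof.
move=> z1; rewrite /fejer rmorphM fmorphV rmorph_nat /= -mul_conj.
rewrite rmorph_sum /= mulr_suml; congr (_ * _); apply: eq_bigr => k _.
rewrite mulr_sumr; apply: eq_bigr => l _.
by rewrite rmorphXn /= conj_unit // exprVn.
Qed.

(** The geometric sum gives $|(1-z)\sum_{k<N} z^k| = |1-z^N| \le 2$. *)
Lemma fejer_le N z (d : R) : nm z = 1 -> 0 < d -> d <= nm (1 - z) ->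
  fejer N z <= 4 / (N%:R * d ^+ 2).
Proof.
move=> z1 d0 dz; have dz0 : 0 < nm (1 - z) by apply: lt_le_trans dz.
rewrite invfM mulrCA ler_wpM2l ?invr_ge0 // ler_pdivlMr ?exprn_gt0 //.
have -> : 4 = 2 ^+ 2 :> R by rewrite -natrX.
rewrite -exprMn ler_pXn2r ?nnegrE ?mulr_ge0 ?nm_ge0 ?(ltW d0) //.
apply: (@le_trans _ _ (nm ((1 - z) * \sum_(k < N) z ^+ k))).
  by rewrite nmM mulrC ler_wpM2r ?nm_ge0.
have -> : (1 - z) * \sum_(k < N) z ^+ k = 1 - z ^+ N.
  by rewrite -opprB mulNr -subrX1 opprB.
by apply: le_trans (nmB _ _) _; rewrite nm1 nmX z1 expr1n.
Qed.

Local Notation W M := (@unity_root R M).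

Lemma nm_node M z j : nm z = 1 -> nm (z / W M ^+ j) = 1.
Proof. by move=> z1; rewrite nm_div nmX nm_unity expr1n divr1. Qed.

Lemma sum_unity_pair M k l : (k < M)%N -> (l < M)%N ->
  \sum_(j < M) (W M ^+ j) ^- k * (W M ^+ j) ^+ l = if k == l then M%:R else 0.
Proof.
have W0 := @unity_neq0 R M.
have key (n k' : nat) : (0 < n)%N -> (n + k' < M)%N ->
    \sum_(j < M) (W M ^+ j) ^- k' * (W M ^+ j) ^+ (n + k') = 0.
  move=> n0 nM; rewrite -[RHS](@sum_unity_root R M n); last first.
    by rewrite n0 (leq_ltn_trans (leq_addr _ _) nM).
  apply: eq_bigr => j _; rewrite exprD mulrCA mulVf ?mulr1 ?expf_neq0 //.
  by rewrite -exprM mulnC.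
move=> kM lM; have [->|kl] := eqVneq.
  under eq_bigr => j _ do rewrite mulVf ?expf_neq0 //.
  by rewrite sumr_const card_ord.
move: kl; rewrite neq_ltn => /orP[lt|lt].
  by rewrite -(subnK (ltnW lt)) key ?subn_gt0 // subnK // ltnW.
apply: (can_inj (@conjcK R)); rewrite conjc0 rmorph_sum /=.
rewrite -[RHS](@key (k - l)%N l) ?subn_gt0 ?subnK ?(ltnW lt) //.
apply: eq_bigr => j _; rewrite conjcM conjc_inv !conjcX.
by rewrite (conj_unit (nm_unity M)) !exprVn invrK mulrC.
Qed.

(** For [N <= M] the exponents $k-l$ lie strictly between $-M$ and $M$, so only the diagonal
    survives: the kernel has mean exactly 1 over the nodes. *)
Lemma sum_fejer M N z : (0 < N)%N -> (N <= M)%N -> nm z = 1 ->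
  \sum_(j < M) fejer N (z / W M ^+ j) = M%:R.
Proof.
move=> N0 NM z1; apply: complexI; rewrite rmorph_sum rmorph_nat /=.
under eq_bigr => j _ do rewrite fejerE ?nm_node //.
have NC : N%:R != 0 :> C by rewrite pnatr_eq0 -lt0n.
have z0 := unit_neq0 z1; have W0 := @unity_neq0 R M.
rewrite -mulr_sumr exchange_big /=.
have -> : \sum_(k < N) \sum_(j < M) \sum_(l < N) (z / W M ^+ j) ^+ k * (z / W M ^+ j) ^- l
    = \sum_(k < N) M%:R.
  apply: eq_bigr => k _; rewrite exchange_big /= (bigD1 k) //= [X in _ + X]big1 => [|l lk].
    rewrite addr0; under eq_bigr => j _ do
      rewrite mulfV ?expf_neq0 ?mulf_neq0 ?invr_neq0 ?expf_neq0 //.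
    by rewrite sumr_const card_ord.
  have := @sum_unity_pair M k l (leq_trans (ltn_ord _) NM) (leq_trans (ltn_ord _) NM).
  rewrite -val_eqE eq_sym in lk; rewrite (negPf lk) => s0.
  transitivity (z ^+ k * z ^- l * \sum_(j < M) (W M ^+ j) ^- k * (W M ^+ j) ^+ l).
    rewrite mulr_sumr; apply: eq_bigr => j _.
    have Wj : W M ^+ j != 0 by rewrite expf_neq0.
    by rewrite !expr_div_n; field; rewrite !expf_neq0.
  by rewrite s0 mulr0.
by rewrite sumr_const card_ord -[X in _ * X]mulr_natl mulrA mulVf ?mul1r.
Qed.

Definition fejer_mean M N g z : C :=
  M%:R^-1 * \sum_(j < M) g j * (fejer N (z / W M ^+ j))%:C%C.

Lemma fejer_mean_bound M N g z (k : R) : (0 < N)%N -> (N <= M)%N -> nm z = 1 ->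
  (forall j, (j < M)%N -> nm (g j) <= k) -> nm (fejer_mean M N g z) <= k.
Proof.
move=> N0 NM z1 gk; have M0 : 0 < M%:R :> R by rewrite ltr0n (leq_trans N0).
rewrite nmM nmV nm_nat ler_pdivrMl //; apply: le_trans (nm_sum _ _ _) _.
rewrite -(sum_fejer N0 NM z1) mulr_suml; apply: ler_sum => j _.
by rewrite nmM nm_real ger0_norm ?fejer_ge0 // mulrC ler_wpM2l ?fejer_ge0 ?gk.
Qed.

(** Nodes within [d] of [z] contribute at most [e]. For the others $|g_j-b| \le 2k$ and the kernel
    is at most $4/(Nd^2)$. *)
Lemma fejer_mean_approx M N g z b (k e d : R) : (0 < N)%N -> (N <= M)%N ->
  nm z = 1 -> 0 <= e -> 0 < d -> nm b <= k ->
  (forall j, (j < M)%N -> nm (g j) <= k) ->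
  (forall j, (j < M)%N -> nm (z - W M ^+ j) < d -> nm (g j - b) <= e) ->
  nm (fejer_mean M N g z - b) <= e + 8 * k / (N%:R * d ^+ 2).
Proof.
move=> N0 NM z1 e0 d0 bk gk ge.
have M0 : 0 < M%:R :> R by rewrite ltr0n (leq_trans N0).
have MC : M%:R != 0 :> C by rewrite pnatr_eq0 -lt0n (leq_trans N0).
have -> : fejer_mean M N g z - b =
    M%:R^-1 * \sum_(j < M) (g j - b) * (fejer N (z / W M ^+ j))%:C%C.
  rewrite /fejer_mean; under [in RHS]eq_bigr => j _ do rewrite mulrBl.
  rewrite sumrB mulrBr -mulr_sumr -rmorph_sum sum_fejer // rmorph_nat /=.
  by rewrite mulrCA mulVf // mulr1.
rewrite nmM nmV nm_nat ler_pdivrMl //; apply: le_trans (nm_sum _ _ _) _.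
have -> : M%:R * (e + 8 * k / (N%:R * d ^+ 2)) =
    \sum_(j < M) (e * fejer N (z / W M ^+ j) + 8 * k / (N%:R * d ^+ 2)).
  by rewrite big_split /= -mulr_sumr sum_fejer // sumr_const card_ord -mulr_natl; ring.
have k0 : 0 <= k by apply: le_trans bk; exact: nm_ge0.
have Nd : 0 < N%:R * d ^+ 2 by rewrite mulr_gt0 ?ltr0n ?exprn_gt0.
apply: ler_sum => j _; rewrite nmM nm_real ger0_norm ?fejer_ge0 //.
have f0 := fejer_ge0 N (z / W M ^+ j).
have [lt_d|le_d] := ltP (nm (z - W M ^+ j)) d.
  apply: ler_wpDr; first by rewrite divr_ge0 ?mulr_ge0 // ltW.
  by rewrite ler_wpM2r // ge.
apply: ler_wpDl; first by rewrite mulr_ge0.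
have Wj : W M ^+ j != 0 by rewrite expf_neq0 ?unity_neq0.
have -> : 8 * k / (N%:R * d ^+ 2) = 2 * k * (4 / (N%:R * d ^+ 2)) by ring.
apply: ler_pM; rewrite ?nm_ge0 //.
  by apply: le_trans (nmB _ _) _; have := gk j (ltn_ord j); lra.
apply: fejer_le => //; first exact: nm_node.
have -> : 1 - z / W M ^+ j = - ((z - W M ^+ j) / W M ^+ j) by field.
by rewrite nmN nm_div nmX nm_unity expr1n divr1.
Qed.

(** Coefficients of index [n] and, for [fourierN], of index [-n]; the split keeps exponents
    natural. *)
Definition fourier M g (n : nat) : C := M%:R^-1 * \sum_(j < M) g j / (W M ^+ j) ^+ n.
Definition fourierN M g (n : nat) : C := M%:R^-1 * \sum_(j < M) g j * (W M ^+ j) ^+ n.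

Lemma fejer_meanE M N g z : nm z = 1 -> fejer_mean M N g z =
  \sum_(k < N) \sum_(l < N) N%:R^-1 *
    (if (l <= k)%N then fourier M g (k - l) * z ^+ (k - l)
     else fourierN M g (l - k) * z ^- (l - k)).
Proof.
move=> z1; rewrite /fejer_mean.
under eq_bigr => j _ do rewrite fejerE ?nm_node // mulr_sumr mulr_sumr.
rewrite exchange_big mulr_sumr /=; apply: eq_bigr => k _.
under eq_bigr => j _ do rewrite !mulr_sumr.
rewrite exchange_big mulr_sumr /=; apply: eq_bigr => l _.
have z0 := unit_neq0 z1.
case: leqP => kl; rewrite /fourier /fourierN !mulr_sumr ?mulr_suml ?mulr_sumr;
  apply: eq_bigr => j _; have Wj : W M ^+ j != 0 by rewrite expf_neq0 ?unity_neq0.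
- by rewrite expf_sub ?mulf_neq0 ?invr_neq0 // expr_div_n; ring.
- rewrite -[_ / _ ^+ l]invrK invf_div expf_sub ?mulf_neq0 ?invr_neq0 ?(ltnW kl) //.
  by rewrite expr_div_n invf_div; ring.
Qed.

Lemma fejer_mean_poly M N g : exists q : {poly C},
  forall z, nm z = 1 -> q.[z] = z ^+ N * fejer_mean M N g z.
Proof.
exists (\sum_(k < N) \sum_(l < N) (N%:R^-1 *
    (if (l <= k)%N then fourier M g (k - l) else fourierN M g (l - k))) *: 'X^(N + k - l)).
move=> z z1; rewrite fejer_meanE // horner_sum mulr_sumr; apply: eq_bigr => k _.
rewrite horner_sum mulr_sumr; apply: eq_bigr => l _; rewrite hornerZ hornerXn.
have z0 := unit_neq0 z1.
case: leqP => kl; first by rewrite -addnBA // exprD; ring.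
have -> : z ^+ (N + k - l) = z ^+ N * z ^- (l - k).
  have lN : (l - k <= N)%N by apply: leq_trans (leq_subr _ _) (ltnW (ltn_ord l)).
  have -> : (N + k - l = N - (l - k))%N by rewrite subnBA // ltnW.
  by rewrite expf_sub.
by ring.
Qed.

End Fejer.

(** * Polynomial approximation of bounded holomorphic functions at finitely many points *)

Section HolomorphicApproximation.
Set Implicit Arguments.
Unset Strict Implicit.
Context {R : realType}.
Local Notation C := R[i].
Implicit Types (g f : C -> C) (z : C).

Lemma derivable_cdiff g z : derivable g z 1 -> cdiff g z.
Proof.
move=> /cvg_ex[l /cvgrPdist_lt gl]; exists l => e e0.
have eC : 0 < e%:C%C :> C by rewrite ltcR.
have [d /= d0 dP] := gl _ eC.
(* A positive element of [R[i]] is real. *)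
have [d' d'0 dd] : exists2 d' : R, 0 < d' & d = d'%:C%C.
  move: d0; rewrite ltcE /= => /andP[/eqP d1 d2].
  by exists (complex.Re d) => //; case: (d) d1 => a b /= ->.
exists d' => // z' zd; have [->|zz] := eqVneq z' z.
  by rewrite !subrr mulr0 subrr nm0 mulr0.
have h0 : z' - z != 0 by rewrite subr_eq0.
have := dP (z' - z); rewrite /= sub0r normrN nmE dd ltcR => /(_ zd h0).
rewrite scaler1 subrK nmE ltcR.
have -> : l - (z' - z)^-1 *: (g z' - g z) = - ((g z' - g z - l * (z' - z)) / (z' - z)).
  by rewrite /GRing.scale /=; field.
by rewrite nmN nm_div ltr_pdivrMr ?nm_gt0 // => /ltW.
Qed.

Lemma cdiff_cont g z : cdiff g z -> forall e : R, 0 < e ->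
  exists2 d : R, 0 < d & forall z', nm (z' - z) < d -> nm (g z' - g z) <= e.
Proof.
move=> [l /(_ 1 ltr01)[d d0 dP]] e e0.
have l1 : 0 < 1 + nm l by have := nm_ge0 l; lra.
exists (Num.min d (e / (1 + nm l))); first by rewrite lt_min d0 divr_gt0.
move=> z'; rewrite lt_min => /andP[/dP h1]; rewrite ltr_pdivlMr // => h2.
have := nm_le_sub (g z' - g z) (l * (z' - z)); rewrite nmM.
by have := nm_ge0 l; have := nm_ge0 (z' - z); nra.
Qed.

Lemma cdiffM f g z : cdiff f z -> cdiff g z -> cdiff (fun x => f x * g x) z.
Proof.
move=> fz gz; have gc := cdiff_cont gz; case: fz => l fl; case: gz => m gm.
exists (l * g z + f z * m) => e e0.
have pos (x : C) : 0 < 3 * (nm x + 1) by have := nm_ge0 x; lra.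
have [d1 d10 h1] := fl _ (divr_gt0 e0 (pos (g z))).
have [d2 d20 h2] := gc _ (divr_gt0 e0 (pos l)).
have [d3 d30 h3] := gm _ (divr_gt0 e0 (pos (f z))).
have [d4 d40 h4] := gc 1 ltr01.
exists (Num.min (Num.min d1 d2) (Num.min d3 d4)); first by rewrite !lt_min d10 d20 d30.
move=> z'; rewrite !lt_min => /andP[/andP[/h1 k1 /h2 k2] /andP[/h3 k3 /h4 k4]].
have -> : f z' * g z' - f z * g z - (l * g z + f z * m) * (z' - z) =
    (f z' - f z - l * (z' - z)) * g z' + l * (z' - z) * (g z' - g z)
    + f z * (g z' - g z - m * (z' - z)) by ring.
apply: le_trans (nmD _ _) _; apply: le_trans (lerD (nmD _ _) (lexx _)) _.
rewrite !nmM; have gz' : nm (g z') <= nm (g z) + 1.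
  by have := nm_le_sub (g z') (g z); lra.
have third (x y c : R) : 0 <= c -> 0 <= x -> x <= c + 1 -> 0 <= y ->
    x * (e / (3 * (c + 1)) * y) <= e / 3 * y.
  move=> c0 x0 xc y0; rewrite mulrA ler_wpM2r // mulrA ler_pdivrMr; last by lra.
  have -> : e / 3 * (3 * (c + 1)) = (c + 1) * e by field.
  by rewrite ler_wpM2r // ltW.
set h := nm (z' - z) in k1 k3 *; have h0 : 0 <= h by exact: nm_ge0.
have t1 : nm (f z' - f z - l * (z' - z)) * nm (g z') <= e / 3 * h.
  rewrite mulrC; apply: le_trans (third _ h _ (nm_ge0 (g z)) (nm_ge0 (g z')) gz' h0).
  by rewrite ler_wpM2l ?nm_ge0.
have t2 : nm l * h * nm (g z' - g z) <= e / 3 * h.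
  have l1 : nm l <= nm l + 1 by lra.
  rewrite -mulrA; apply: le_trans (third _ h _ (nm_ge0 l) (nm_ge0 l) l1 h0).
  by rewrite ler_wpM2l ?nm_ge0 // mulrC ler_wpM2r.
have t3 : nm (f z) * nm (g z' - g z - m * (z' - z)) <= e / 3 * h.
  have l1 : nm (f z) <= nm (f z) + 1 by lra.
  apply: le_trans (third _ h _ (nm_ge0 (f z)) (nm_ge0 (f z)) l1 h0).
  by rewrite ler_wpM2l ?nm_ge0.
by lra.
Qed.

Lemma cdiff_exp n z : cdiff (fun x => x ^+ n) z.
Proof.
elim: n => [|n IHn].
  exists 0 => e e0; exists 1 => // z' _.
  by rewrite !expr0 subrr mul0r subrr nm0 mulr_ge0 ?nm_ge0 ?ltW.
under eq_fun do rewrite exprS; apply: cdiffM IHn.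
exists 1 => e e0; exists 1 => // z' _.
by rewrite mul1r subrr nm0 mulr_ge0 ?nm_ge0 ?ltW.
Qed.

Lemma cdiff_expV n z : z != 0 -> cdiff (fun x => x ^- n) z.
Proof.
move=> z0; have zp : 0 < nm z by rewrite nm_gt0.
have inv : cdiff (fun x => x^-1) z.
  exists (- z ^- 2) => e e0.
  exists (Num.min (nm z / 2) (e * nm z ^+ 3 / 2)).
    by rewrite lt_min !divr_gt0 ?mulr_gt0 ?exprn_gt0.
  move=> z'; rewrite lt_min => /andP[h1 h2].
  have h3 : nm z / 2 <= nm z' by have := nm_le_sub z z'; rewrite (nmC z); lra.
  have z'p : 0 < nm z' by lra.
  have z'0 : z' != 0 by rewrite -nm_gt0.
  have -> : z'^-1 - z^-1 - - z ^- 2 * (z' - z) = (z' - z) * (z' - z) / (z ^+ 2 * z').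
    by field; rewrite z0 z'0.
  rewrite nm_div (nmM (z' - z)) (nmM (z ^+ 2)) nmX ler_pdivrMr ?mulr_gt0 ?exprn_gt0 // -mulrA mulrCA mulrC.
  rewrite ler_wpM2l ?nm_ge0 //.
  apply: le_trans (ltW h2) _.
  have -> : e * nm z ^+ 3 / 2 = e * nm z ^+ 2 * (nm z / 2) by field.
  by rewrite -mulrA (ler_pM2l e0) ler_pM2l ?exprn_gt0.
elim: n => [|n IHn].
  by under eq_fun do rewrite expr0 invr1 -(expr0 1); exact: (cdiff_exp 0).
by under eq_fun do rewrite exprS invfM; exact: cdiffM.
Qed.

Lemma eventually_all (T : eqType) (s : seq T) (P : T -> nat -> Prop) :
  {in s, forall x, exists N, forall m, (N <= m)%N -> P x m} ->
  exists N, forall m, (N <= m)%N -> {in s, forall x, P x m}.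
Proof.
elim: s => [|x s IHs] h; first by exists 0%N.
have [|N NP] := IHs; first by move=> y ys; apply: h; rewrite inE ys orbT.
have [|N' NP'] := h x; first exact: mem_head.
exists (N + N')%N => m Nm y; rewrite inE => /predU1P[->|ys].
  by apply: NP'; apply: leq_trans Nm; rewrite leq_addl.
by apply: NP => //; apply: leq_trans Nm; rewrite leq_addr.
Qed.

Lemma common_radius (T : eqType) (s : seq T) (P : T -> R -> Prop) :
  (forall x d d', P x d -> d' <= d -> P x d') ->
  {in s, forall x, exists2 d, 0 < d & P x d} ->
  exists2 d, 0 < d & {in s, forall x, P x d}.
Proof.
move=> mono; elim: s => [|x s IHs] h; first by exists 1.
have [|d d0 dP] := IHs; first by move=> y ys; apply: h; rewrite inE ys orbT.
have [|d' d'0 dP'] := h x; first exact: mem_head.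
exists (Num.min d d'); first by rewrite lt_min d0.
move=> y; rewrite inE => /predU1P[->|ys].
  by apply: mono dP' _; rewrite ge_min lexx orbT.
by apply: mono (dP _ ys) _; rewrite ge_min lexx.
Qed.

(** The divided difference of $p$ at $w$ is a polynomial, so its bound on the circle, where $|x-w|
    \ge 1-r$, extends to the disc. *)
Lemma poly_schwarz (p : {poly C}) (b r : R) z w : r < 1 ->
  (forall x, nm x = 1 -> nm p.[x] <= b) -> nm z <= 1 -> nm w <= r ->
  nm (p.[z] - p.[w]) <= 2 * b / (1 - r) * nm (z - w).
Proof.
move=> r1 pb z1 wr.
have pb1 := poly_max_principle pb.
have w1 : nm w <= 1 by apply: le_trans wr (ltW r1).
have /factor_theorem[q qE] : root (p - p.[w]%:P) w.
  by apply/rootP; rewrite !hornerE subrr.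
have qE' x : p.[x] - p.[w] = q.[x] * (x - w).
  by have := congr1 (fun t => t.[x]) qE; rewrite !hornerE.
rewrite qE' nmM ler_wpM2r ?nm_ge0 //; move: z z1; apply: poly_max_principle.
move=> x x1; have xw : 1 - r <= nm (x - w).
  by have := nm_le_sub x w; rewrite x1; lra.
rewrite ler_pdivlMr ?subr_gt0 //.
apply: le_trans (_ : nm q.[x] * nm (x - w) <= _).
  by rewrite ler_wpM2l ?nm_ge0.
rewrite -nmM -qE'; apply: le_trans (nmB _ _) _.
by have := pb x x1; have := pb1 w w1; lra.
Qed.

Section Schur.
Variable f : C -> C.
Hypothesis fd : forall z, nm z < 1 -> derivable f z 1.
Hypothesis f1 : forall z, nm z < 1 -> nm (f z) <= 1.

Let sample r M (j : nat) := f (r%:C%C * unity_root M ^+ j).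

Let nm_sample (r : R) M j : 0 < r -> nm (r%:C%C * unity_root M ^+ j) = r.
Proof. by move=> r0; rewrite nmM nm_real nmX nm_unity expr1n mulr1 ger0_norm ?ltW. Qed.

(** Coefficients are contour means of $f(z)z^{-n-1}$, so [cmean_cvg] compares them at different
    radii. *)
Let cmean_fourier r M n : 0 < r ->
  cmean (fun z => f z * z ^- n.+1) r M = r%:C%C ^- n * fourier M (sample r M) n.
Proof.
move=> r0; rewrite /cmean /fourier mulrCA; congr (_ * _); rewrite mulr_sumr.
apply: eq_bigr => j _; rewrite /sample.
set z := r%:C%C * _; have z0 : z != 0 by rewrite -nm_gt0 /z nm_sample.
rewrite [in RHS]mulrCA -invfM -exprMn -/z exprS invfM -mulrA; congr (_ * _).
by rewrite mulrAC mulVf // mul1r.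
Qed.

Let cmean_fourierN r M n : 0 < r ->
  cmean (fun z => f z * z ^+ n) r M = r%:C%C ^+ n.+1 * fourierN M (sample r M) n.+1.
Proof.
move=> r0; rewrite /cmean /fourierN mulrCA; congr (_ * _); rewrite mulr_sumr.
apply: eq_bigr => j _; rewrite /sample; set z := r%:C%C * _.
by rewrite [in RHS]mulrCA -exprMn -/z -mulrA -exprSr.
Qed.

Let fourierN_le r M n : 0 < r -> r < 1 -> (0 < M)%N -> nm (fourierN M (sample r M) n) <= 1.
Proof.
move=> r0 r1 M0; have MR : 0 < M%:R :> R by rewrite ltr0n.
rewrite /fourierN nmM nmV nm_nat ler_pdivrMl // mulr1.
apply: le_trans (nm_sum _ _ _) _; rewrite -[M in leRHS]card_ord -sumr_const.
apply: ler_sum => j _; rewrite nmM !nmX nm_unity !expr1n mulr1 f1 //.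
by rewrite nm_sample.
Qed.

Let fourier_cvg n r1 r2 : 0 < r1 -> r1 < r2 -> r2 < 1 -> forall e, 0 < e ->
  exists N, forall m, (N <= m)%N ->
  nm (fourier (2 ^ m) (sample r1 (2 ^ m)) n
      - fourier (2 ^ m) (sample r2 (2 ^ m)) n * (r1 / r2)%:C%C ^+ n) <= e.
Proof.
move=> r10 r12 r21 e e0; have r20 := lt_trans r10 r12.
have [z z01|N NP] := cmean_cvg (g := fun z => f z * z ^- n.+1) r10 r12 r21 _ e0.
  have /andP[z0 z1] := z01; rewrite nm_gt0 in z0.
  by apply: cdiffM; [exact/derivable_cdiff/fd | exact: cdiff_expV].
exists N => m /NP; rewrite !cmean_fourier // nmC.
set a := fourier _ _ _; set b := fourier _ _ _ => h.
have r1C : r1%:C%C != 0 :> C by rewrite -nm_gt0 nm_real gtr0_norm.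
have r2C : r2%:C%C != 0 :> C by rewrite -nm_gt0 nm_real gtr0_norm.
clearbody a b.
have -> : a - b * (r1 / r2)%:C%C ^+ n =
    r1%:C%C ^+ n * (r1%:C%C ^- n * a - r2%:C%C ^- n * b).
  rewrite rmorphM fmorphV exprMn exprVn; field.
  by rewrite !expf_neq0.
rewrite nmM; apply: le_trans h; rewrite ler_piMl ?nm_ge0 // nmX nm_real gtr0_norm //.
by rewrite exprn_ile1 ?ltW // (lt_trans r12).
Qed.

(** $r^{n+1}$ times the coefficient is asymptotically independent of the radius, and at a tiny
    radius [q] it is at most [q]. *)
Let fourierN_cvg n r : 0 < r -> r < 1 -> forall e, 0 < e ->
  exists N, forall m, (N <= m)%N ->
  nm (fourierN (2 ^ m) (sample r (2 ^ m)) n.+1) <= e.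
Proof.
move=> r0 r1 e e0; have rn : 0 < r ^+ n.+1 by rewrite exprn_gt0.
pose e' := e * r ^+ n.+1 / 2; have e'0 : 0 < e' by rewrite divr_gt0 ?mulr_gt0.
(* [q] and the comparison error each use half of $e\,r^{n+1}$. *)
pose q := Num.min (r / 2) e'.
have q0 : 0 < q by rewrite lt_min e'0 divr_gt0.
have qr : q < r by rewrite gt_min; apply/orP; left; lra.
have qe : q <= e' by rewrite ge_min lexx orbT.
have [z /andP[z0 z1]|N NP] := cmean_cvg (g := fun z => f z * z ^+ n) q0 qr r1 _ e'0.
  by apply: cdiffM; [exact/derivable_cdiff/fd | exact: cdiff_exp].
exists N => m /NP; rewrite !cmean_fourierN //.
set a := fourierN _ _ _; set b := fourierN _ _ _ => h.
have b1 : nm b <= 1 by rewrite fourierN_le ?expn_gt0 // (lt_trans qr).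
clearbody a b; have := nm_le_sub (r%:C%C ^+ n.+1 * a) (q%:C%C ^+ n.+1 * b).
rewrite !nmM !nmX !nm_real !gtr0_norm // => h2.
have qn : q ^+ n.+1 <= q.
  have qn1 : q ^+ n <= 1 by apply: exprn_ile1; lra.
  by rewrite exprS ler_piMr // ltW.
have qb : q ^+ n.+1 * nm b <= q.
  by apply: le_trans qn; rewrite ler_piMr // exprn_ge0 ?ltW.
rewrite -(ler_pM2l rn); apply: le_trans h2 _.
apply: le_trans (lerD qb h) _.
by rewrite [leRHS]mulrC -/(e * r ^+ n.+1); move: qe; rewrite /e'; lra.
Qed.

(** A point $z = |z|u$ of [s] is reached through the circle of radius $r_0|z|$: there the Fejér mean
    at $u$ is close to $f(z)$, and close to $p(z)$ as Taylor coefficients scale with the radius.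
    Convergence holds radius by radius, whence a finite list; a positive radius is needed, whence $z
    \ne 0$. *)
Lemma schur_poly_approx (s : seq C) (e : R) : 0 < e ->
  {in s, forall z, z != 0 /\ nm z < 1} ->
  exists p : {poly C}, (forall z, nm z = 1 -> nm p.[z] <= 1 + e) /\
    {in s, forall z, nm (p.[z] - f z) <= e}.
Proof.
move=> e0 s1; pose e1 := e / 4; have e10 : 0 < e1 by rewrite divr_gt0.
have [d d0 dP] : exists2 d, 0 < d & {in s, forall z,
    forall z', nm (z' - z) < d -> nm (f z' - f z) <= e1}.
  apply: common_radius => [x d d' h dd z' zd|z zs].
    by apply: h; apply: lt_le_trans dd.
  by apply: cdiff_cont e10; apply/derivable_cdiff/fd; have [] := s1 z zs.
(* Shrinking by [r0] moves a point of the disc by less than $d/2$; a node within $d/2$ of $u$ uses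
   the other half of [d]. *)
pose r0 := Num.max (1 / 2) (1 - d / 4).
have r00 : 0 < r0 by rewrite lt_max; apply/orP; left; lra.
have r01 : r0 < 1 by rewrite gt_max; apply/andP; split; lra.
have r0d : 1 - r0 < d / 2.
  have : 1 - d / 4 <= r0 by rewrite le_max lexx orbT.
  by lra.
pose N := (Num.truncn (8 / (e1 * (d / 2) ^+ 2))).+1.
have dd : 0 < e1 * (d / 2) ^+ 2 by rewrite mulr_gt0 ?exprn_gt0 ?divr_gt0.
have N0 : 0 < N%:R :> R by rewrite ltr0n.
have NP : 8 * 1 / (N%:R * (d / 2) ^+ 2) <= e1.
  have := ltW (truncnS_gt (8 / (e1 * (d / 2) ^+ 2))).
  rewrite -/N ler_pdivrMr // mulr1 ler_pdivrMr; last by rewrite mulr_gt0 ?exprn_gt0 ?divr_gt0.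
  by move=> h; apply: le_trans h _; rewrite mulrCA.
have Npos : (0 < N)%N by [].
clearbody N r0.
have eN : 0 < e1 / N%:R by rewrite divr_gt0.
have s0 z : z \in s -> 0 < nm z by move=> /s1[]; rewrite nm_gt0.
have s1' z : z \in s -> nm z < 1 by move=> /s1[].
have small z : z \in s -> 0 < r0 * nm z /\ r0 * nm z < r0.
  by move=> zs; have := s0 z zs; have := s1' z zs; split; nra.
have [m [Nm [A1 A2 A3]]] : exists m, (N <= 2 ^ m)%N /\
    [/\ {in iota 0 N, forall n, nm (fourierN (2 ^ m) (sample r0 (2 ^ m)) n.+1) <= e1 / N%:R},
     {in s, forall z, {in iota 0 N, forall n,
        nm (fourierN (2 ^ m) (sample (r0 * nm z) (2 ^ m)) n.+1) <= e1 / N%:R}} &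
     {in s, forall z, {in iota 0 N, forall n,
        nm (fourier (2 ^ m) (sample (r0 * nm z) (2 ^ m)) n
         - fourier (2 ^ m) (sample r0 (2 ^ m)) n * (r0 * nm z / r0)%:C%C ^+ n) <= e1 / N%:R}}].
  have [N1 h1] := @eventually_all _ (iota 0 N) _
    (fun n _ => @fourierN_cvg n r0 r00 r01 _ eN).
  have [N2 h2] := @eventually_all _ s _ (fun z zs => @eventually_all _ (iota 0 N) _
    (fun n _ => @fourierN_cvg n _ (small z zs).1 (lt_trans (small z zs).2 r01) _ eN)).
  have [N3 h3] := @eventually_all _ s _ (fun z zs => @eventually_all _ (iota 0 N) _
    (fun n _ => @fourier_cvg n _ _ (small z zs).1 (small z zs).2 r01 _ eN)).
  exists (N + N1 + N2 + N3)%N; split.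
    apply: leq_trans (ltnW (ltn_expl _ (ltnSn 1))).
    by rewrite -!addnA leq_addr.
  split; [apply: h1 | apply: h2 | apply: h3].
  - by rewrite -!addnA addnCA leq_addr.
  - by rewrite addnAC leq_addl.
  - by rewrite leq_addl.
move: (2 ^ m)%N Nm A1 A2 A3 => M Nm A1 A2 A3.
pose p : {poly C} := \sum_(k < N) \sum_(l < N) N%:R^-1 *:
  (if (l <= k)%N then fourier M (sample r0 M) (k - l) *: 'X^(k - l) else 0).
(* Term by term: $N^2$ terms of weight $1/N$, each with error at most $e_1/N$. The terms with $k<l$
   are absent from [p] and nearly vanish in the mean. *)
have dist z r : nm z = 1 -> 0 <= r -> r <= 1 ->
    {in iota 0 N, forall n, nm (fourierN M (sample (r0 * r) M) n.+1) <= e1 / N%:R} ->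
    {in iota 0 N, forall n, nm (fourier M (sample (r0 * r) M) n -
        fourier M (sample r0 M) n * r%:C%C ^+ n) <= e1 / N%:R} ->
    nm (p.[r%:C%C * z] - fejer_mean M N (sample (r0 * r) M) z) <= e1.
  move=> z1 r_0 r_1 hN hP; rewrite fejer_meanE // /p horner_sum -sumrB.
  apply: le_trans (nm_sum _ _ _) _.
  have -> : e1 = \sum_(k < N) \sum_(l < N) N%:R^-1 * (e1 / N%:R).
    rewrite !sumr_const !card_ord -mulrnA -[RHS]mulr_natr natrM; field.
    exact: lt0r_neq0.
  apply: ler_sum => k _; rewrite horner_sum -sumrB.
  apply: le_trans (nm_sum _ _ _) _; apply: ler_sum => l _.
  rewrite hornerZ -mulrBr nmM nmV nm_nat ler_wpM2l ?invr_ge0 //.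
  have [kl|kl] := leqP l k.
    rewrite hornerZ hornerXn exprMn mulrA -mulrBl nmM nmX z1 expr1n mulr1 nmC.
    apply: hP; rewrite mem_iota /= add0n.
    exact: leq_ltn_trans (leq_subr _ _) (ltn_ord k).
  rewrite horner0 sub0r nmN nmM nmV nmX z1 expr1n invr1 mulr1.
  have -> : (l - k = (l - k).-1.+1)%N by rewrite prednK // subn_gt0.
  apply: hN; rewrite mem_iota /= add0n -subnS.
  exact: leq_ltn_trans (leq_subr _ _) (ltn_ord l).
have sb r : 0 < r -> r <= 1 -> forall j, (j < M)%N -> nm (sample (r0 * r) M j) <= 1.
  by move=> r_0 r_1 j _; apply: f1; rewrite nm_sample ?mulr_gt0 //; nra.
exists p; split=> [z z1|z zs].
  have := @dist z 1 z1 ler01 (lexx _); rewrite mulr1 rmorph1 mul1r => dz.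
  have {}dz := dz A1 _; have {dz} : nm (p.[z] - fejer_mean M N (sample r0 M) z) <= e1.
    apply: dz => n _; rewrite expr1n mulr1 subrr nm0 ltW //.
  have := @fejer_mean_bound R M N (sample r0 M) z 1 Npos Nm z1.
  have := sb 1 ltr01 (lexx _); rewrite mulr1 => sb1 /(_ sb1).
  have := nm_le_sub p.[z] (fejer_mean M N (sample r0 M) z).
  by rewrite /e1; lra.
have z0 := s0 z zs; have z1 := s1' z zs.
have znC : (nm z)%:C%C != 0 :> C by rewrite -nm_gt0 nm_real gtr0_norm.
pose u := z / (nm z)%:C%C.
have zu : z = (nm z)%:C%C * u by rewrite /u mulrCA mulfV // mulr1.
have u1 : nm u = 1 by rewrite nm_div nm_real gtr0_norm // divff // gt_eqF.
have rz : r0 * nm z / r0 = nm z by field; exact: lt0r_neq0.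
have dz : nm (p.[z] - fejer_mean M N (sample (r0 * nm z) M) u) <= e1.
  rewrite [in p.[z]]zu; apply: dist => //; [exact: ltW|exact: ltW|exact: A2|].
  by move=> n nN; have := A3 z zs n nN; rewrite rz.
have fz : nm (fejer_mean M N (sample (r0 * nm z) M) u - f z) <=
    e1 + 8 * 1 / (N%:R * (d / 2) ^+ 2).
  apply: fejer_mean_approx => //; [exact: ltW|by rewrite divr_gt0|exact: f1| |].
    by apply: sb => //; exact: ltW.
  move=> j jM uj; apply: dP => //.
  set W := unity_root M ^+ j in uj *.
  have -> : (r0 * nm z)%:C%C * W - z = (r0 * nm z)%:C%C * (W - u) - (1 - r0)%:C%C * z.
    have -> : (r0 * nm z)%:C%C * (W - u) = (r0 * nm z)%:C%C * W - r0%:C%C * z.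
      by rewrite [X in _ = _ - _ * X]zu rmorphM /=; ring.
    by rewrite rmorphB rmorph1 /=; ring.
  apply: le_lt_trans (nmB _ _) _; rewrite !nmM !nm_real nmC.
  rewrite !ger0_norm ?subr_ge0 ?ltW ?mulr_gt0 //.
  have rz1 : r0 * nm z <= 1 by have [_ hz] := small z zs; apply/ltW/(lt_trans hz).
  have a1 : r0 * nm z * nm (u - W) <= nm (u - W) by rewrite ler_piMl ?nm_ge0.
  have a2 : (1 - r0) * nm z <= 1 - r0 by rewrite ler_piMr ?subr_ge0 ?(ltW r01) ?(ltW z1).
  by apply: le_lt_trans (lerD a1 a2) _; lra.
have := nm_tri p.[z] (fejer_mean M N (sample (r0 * nm z) M) u) (f z).
by move: dz fz NP; rewrite /e1; lra.
Qed.

End Schur.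
End HolomorphicApproximation.

(** * Covering a compact null set of the circle by disjoint short arcs *)

Section NullCover.
Set Implicit Arguments.
Unset Strict Implicit.
Context {R : realType}.
Local Notation C := R[i].
Implicit Types (p q : R * R) (l : seq (R * R)) (S : set R) (K : set C).

Definition total l : R := \sum_(p <- l) (p.2 - p.1).

Definition disjoint_itvs l : bool :=
  all (fun p => p.1 < p.2) l && pairwise (fun p q => p.2 < q.1) l.

(** Insertion into a sorted list; an interval that meets [p] is absorbed and the hull is inserted
    further on, so the total length does not exceed the sum. *)
Fixpoint insert_itv p l := match l with
  | [::] => [:: p]
  | q :: l' => if p.2 < q.1 then p :: l
               else if q.2 < p.1 then q :: insert_itv p l'
               else insert_itv (Num.min p.1 q.1, Num.max p.2 q.2) l'
  end.

Lemma insert_itv_bounds p l (lo hi : R) : lo <= p.1 -> p.2 <= hi ->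
  all (fun q => (lo <= q.1) && (q.2 <= hi)) l ->
  all (fun q => (lo <= q.1) && (q.2 <= hi)) (insert_itv p l).
Proof.
elim: l p => [|q l IHl] p h1 h2 /=; first by rewrite h1 h2.
move=> /andP[/andP[h3 h4] al].
case: ifP => _ /=; first by rewrite h1 h2 h3 h4 al.
case: ifP => _ /=; first by rewrite h3 h4 IHl.
by apply: IHl => //=; rewrite ?le_min ?ge_max ?h1 ?h2 ?h3 ?h4.
Qed.

Lemma insert_itv_lt p l (b : R) : b < p.1 ->
  all (fun q => b < q.1) l -> all (fun q => b < q.1) (insert_itv p l).
Proof.
elim: l p => [|q l IHl] p h1 /=; first by rewrite h1.
move=> /andP[h3 al].
case: ifP => _ /=; first by rewrite h1 h3 al.
case: ifP => _ /=; first by rewrite h3 IHl.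
by apply: IHl => //=; rewrite lt_min h1 h3.
Qed.

Lemma insert_itv_disjoint p l : p.1 < p.2 -> disjoint_itvs l ->
  disjoint_itvs (insert_itv p l).
Proof.
rewrite /disjoint_itvs; elim: l p => [|q l IHl] p pp /=; first by rewrite pp.
move=> /andP[/andP[qq al] /andP[ql pl]].
have pl' : p.2 < q.1 -> all (fun r => p.2 < r.1) l.
  by move=> pq; apply: sub_all ql => r qr; apply: lt_trans qr; apply: lt_trans qq.
case: ifP => pq /=; first by rewrite pp qq al ql pl pq pl'.
have {}IHl p' : p'.1 < p'.2 -> all (fun r => r.1 < r.2) (insert_itv p' l) &&
    pairwise (fun r s => r.2 < s.1) (insert_itv p' l).
  by move=> pp'; apply: IHl => //; rewrite al pl.
case: ifP => qp /=.
  by have /andP[-> ->] := IHl _ pp; rewrite qq insert_itv_lt.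
by apply: IHl => /=; rewrite gt_min lt_max pp.
Qed.

Lemma insert_itv_total p l : p.1 < p.2 -> disjoint_itvs l ->
  total (insert_itv p l) <= p.2 - p.1 + total l.
Proof.
rewrite /total; elim: l p => [|q l IHl] p pp.
  by rewrite /= big_seq1 big_nil addr0.
rewrite /disjoint_itvs /= => /andP[/andP[qq al] /andP[ql pl]].
have dl : disjoint_itvs l by rewrite /disjoint_itvs al pl.
case: ifP => pq; first by rewrite !big_cons.
case: ifP => qp; rewrite !big_cons; first by have := IHl _ pp dl; lra.
move/negbT: pq; move/negbT: qp; rewrite -!leNgt => qp pq.
apply: le_trans (IHl _ _ dl) _ => /=; first by rewrite gt_min lt_max pp.
rewrite addrA lerD2r.
by case: (leP p.1 q.1) => ?; case: (leP p.2 q.2) => ?; lra.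
Qed.

Lemma insert_itv_cover p l (s : R) :
  (p.1 <= s <= p.2) || has (fun q => q.1 <= s <= q.2) l ->
  has (fun q => q.1 <= s <= q.2) (insert_itv p l).
Proof.
elim: l p => [|q l IHl] p //=.
case: ifP => _ /=; first by [].
case: ifP => _ /=.
  case/or3P => h; [|by rewrite h|]; by apply/orP; right; apply: IHl; rewrite h ?orbT.
move=> h; apply: IHl => /=; rewrite ge_min le_max.
case/or3P: h => [/andP[-> ->] //|/andP[-> ->]|->]; by rewrite ?orbT.
Qed.

Definition merge_itvs l := foldr insert_itv [::] l.

Lemma merge_itvsP l (lo hi : R) :
  all (fun p => [&& p.1 < p.2, lo <= p.1 & p.2 <= hi]) l ->
  [/\ disjoint_itvs (merge_itvs l),
      all (fun p => (lo <= p.1) && (p.2 <= hi)) (merge_itvs l),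
      total (merge_itvs l) <= total l
    & forall s, has (fun p => p.1 <= s <= p.2) l ->
        has (fun p => p.1 <= s <= p.2) (merge_itvs l)].
Proof.
elim: l => [|p l IHl] /=; first by rewrite /total big_nil.
move=> /andP[/and3P[pp h1 h2] /IHl[d1 d2 d3 d4]]; split.
- exact: insert_itv_disjoint.
- exact: insert_itv_bounds.
- apply: le_trans (insert_itv_total pp d1) _.
  by rewrite /total big_cons lerD2l.
- move=> s h; apply: insert_itv_cover; case/orP: h => [->//|/d4 ->].
  by rewrite orbT.
Qed.

Lemma disjoint_itvs_gap l : disjoint_itvs l ->
  exists2 d, 0 < d & pairwise (fun p q => p.2 + d < q.1) l.
Proof.
rewrite /disjoint_itvs => /andP[_]; elim: l => [|p l IHl] /=; first by exists 1.
move=> /andP[pl /IHl[d d0 dl]].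
have [d' d'0 d'P] : exists2 d, 0 < d & all (fun q => p.2 + d < q.1) l.
  elim: (l) pl => [|q r IHr] /=; first by exists 1.
  move=> /andP[pq /IHr[e e0 er]].
  exists (Num.min e ((q.1 - p.2) / 2)).
    by rewrite lt_min e0 divr_gt0 // subr_gt0.
  apply/andP; split.
    have : Num.min e ((q.1 - p.2) / 2) <= (q.1 - p.2) / 2 by rewrite ge_min lexx orbT.
    by lra.
  apply: sub_all er => x; apply: le_lt_trans; rewrite lerD2l.
  by rewrite ge_min lexx.
exists (Num.min d d'); first by rewrite lt_min d0.
apply/andP; split.
  apply: sub_all d'P => x; apply: le_lt_trans; rewrite lerD2l.
  by rewrite ge_min lexx orbT.
apply: sub_pairwise dl => x y; apply: le_lt_trans; rewrite lerD2l.
by rewrite ge_min lexx.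
Qed.

(** Lebesgue measure is an outer measure defined by open interval covers, and compactness leaves
    finitely many intervals. *)
Lemma compact_null_itvs S (e : R) : compact S -> lebesgue_measure S = 0%E -> 0 < e ->
  exists l, [/\ all (fun p => p.1 < p.2) l, total l < e
    & forall s, S s -> has (fun p => p.1 < s < p.2) l].
Proof.
move=> cS S0 e0.
have [F [Fitv SF] Fe] : exists2 F, open_itv_cover S F &
    (\sum_(0 <= k <oo) wlength idfun (F k) < e%:E)%E.
  have S0' : ((wlength (@idfun R))^* S)%mu = 0%E by exact: S0.
  have : ((wlength (@idfun R))^* S)%mu \is a fin_num by rewrite S0'.
  rewrite outer_measure_open_itv_cover => fS'.
  have [_ [F SF <-] Fe] := lb_ereal_inf_adherent e0 fS'.
  exists F => //; apply: lt_le_trans Fe _.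
  by rewrite -outer_measure_open_itv_cover S0' add0e.
have [ab abP] := choice Fitv.
have := cS; rewrite compact_cover => /(_ nat setT F) [||D _ SD].
- by move=> i _; rewrite abP; exact: interval_open.
- by move=> s /SF [i _ Fs]; exists i.
have [n nP] : exists n, forall i, i \in finmap.enum_fset D -> (i < n)%N.
  exists (\max_(i <- finmap.enum_fset D) i).+1 => i iD.
  by rewrite ltnS; exact: (@leq_bigmax_seq _ (finmap.enum_fset D) xpredT (fun k => k) i iD isT).
(* All indices below [n] are kept, not only those of the subcover, so that the total is a partial
   sum of the series. *)
exists [seq ab i | i <- iota 0 n & (ab i).1 < (ab i).2]; split.
- by rewrite all_map; apply/allP => i; rewrite mem_filter => /andP[].
- rewrite -lte_fin; apply: le_lt_trans Fe.
  apply: le_trans (nneseries_lim_ge n _); last first.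
    by move=> k _ _; rewrite abP; exact: wlength_itv_ge0.
  rewrite /total big_map big_filter -sumEFin /index_iota subn0 big_mkcond /=.
  rewrite le_eqVlt; apply/orP; left; apply/eqP; apply: eq_bigr => i _.
  by rewrite abP wlength_itv /= lte_fin; case: ifP.
move=> s /SD [i iD]; rewrite abP /= in_itv /= => si.
apply/hasP; exists (ab i); last exact: si.
apply: map_f; rewrite mem_filter mem_iota leq0n add0n; apply/andP; split.
  by case/andP: si => /lt_trans; apply.
exact: nP.
Qed.

Lemma continuous_expi : continuous (@expi R).
Proof.
move=> t; apply/cvgrPdist_lt => e; rewrite ltcE /= => /andP[/eqP e1 e2].
near=> s; rewrite nmE (_ : e = (complex.Re e)%:C%C); last by case: (e) e1 => a b /= ->.
rewrite ltcR; apply: le_lt_trans (expi_lip _ _) _.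
near: s; exact: cvgr_dist_lt.
Unshelve. all: by end_near. Qed.

(** The whole circle is not null, so some $e^{it_0}$ lies outside the closed set $K$; cutting there,
    with a margin, turns arcs into intervals of one window. *)
Lemma null_circle_cover K : compact K -> K `<=` unit_circle R ->
  arclength K = 0%E -> exists t0 r : R, 0 < r /\ forall e, 0 < e ->
  exists l, [/\ disjoint_itvs l,
    all (fun p => (t0 + r <= p.1) && (p.2 <= t0 + 2 * pi - r)) l, total l < e
    & forall z, K z -> exists s, z = expi s /\ has (fun p => p.1 <= s <= p.2) l].
Proof.
move=> cK K1 K0; have pi0 := pi_gt0 R.
have clK : closed K by apply: compact_closed cK; exact: norm_hausdorff.
have clE : closed (@expi R @^-1` K).
  by apply: preimage_closed => // t _; exact: continuous_expi.
(* The closed interval makes [S] compact at the cost of the null point $2\pi$. *)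
pose S : set R := `[0, 2 * pi] `&` (@expi R @^-1` K).
have cS : compact S.
  apply: (subclosed_compact _ (@segment_compact R 0 (2 * pi))).
    by apply: closedI => //; exact: interval_closed.
  by move=> t [].
have S0 : lebesgue_measure S = 0%E.
  apply/eqP; rewrite eq_le; apply/andP; split; last exact: outer_measure_ge0.
  pose S1 : set R := [set t : R | 0 <= t < 2 * pi /\ K (expi t)].
  have SS : S `<=` S1 `|` [set 2 * pi].
    move=> t [/=]; rewrite in_itv /= => /andP[t0]; rewrite le_eqVlt.
    by move=> /predU1P[->|t1] Kt; [right | left; rewrite /S1 /= t0 t1].
  apply: (@le_trans _ _ (((wlength (@idfun R))^*)%mu (S1 `|` [set 2 * pi]))).
    exact: le_mu_ext.
  apply: le_trans (outer_measureU2 _ _ _) _.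
  rewrite -[X in (_ <= X)%E]adde0 leeD //.
    by rewrite -[X in (_ <= X)%E]K0.
  by rewrite -(lebesgue_measure_set1 (2 * pi : R)).
have [t0 [t00 t01 Kt0]] : exists t0 : R, [/\ 0 <= t0, t0 < 2 * pi & ~ K (expi t0)].
  apply: contrapT => nt.
  have all_S t : 0 <= t < 2 * pi -> K (expi t).
    by move=> /andP[h1 h2]; apply: contrapT => h; apply: nt; exists t.
  have : lebesgue_measure (`[0 : R, 2 * pi[)%classic = 0%E.
    rewrite -[RHS]K0; congr lebesgue_measure; apply/seteqP; split => t /=.
      by rewrite in_itv /= => h; split => //; apply: all_S.
    by rewrite in_itv /= => -[].
  rewrite lebesgue_measure_itv /= lte_fin mulr_gt0 // => -[] /eqP.
  by rewrite oppr0 addr0 gt_eqF // mulr_gt0.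
have [r r0 rP] : exists2 r, 0 < r & forall t, `|t - t0| < r -> ~ K (expi t).
  have : nbhs t0 (~` (@expi R @^-1` K)).
    by apply: open_nbhs_nbhs; split; [exact: closed_openC | exact: Kt0].
  move=> /nbhs_ballP[r /= r0 rP]; exists r => // t tr.
  by apply: rP; rewrite /ball /= distrC.
(* Points of $K$ keep distance [r] from the cut. Clipping at $r/2$ therefore leaves nondegenerate
   every interval used for them. *)
exists t0, (r / 2); split; first by rewrite divr_gt0.
move=> e e0; have e20 : 0 < e / 2 by rewrite divr_gt0.
have [l [l1 l2 l3]] := compact_null_itvs cS S0 e20.
(* The window starts at [t0] and may pass $2\pi$; a translated copy of the cover serves that
   portion, hence the use of $e/2$. *)
pose l' := l ++ [seq (p.1 + 2 * pi, p.2 + 2 * pi) | p <- l].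
pose lo := t0 + r / 2; pose hi := t0 + 2 * pi - r / 2.
pose clip p := (Num.max p.1 lo, Num.min p.2 hi).
pose l'' := [seq p <- map clip l' | p.1 < p.2].
have l''P : all (fun p => [&& p.1 < p.2, lo <= p.1 & p.2 <= hi]) l''.
  apply/allP => p; rewrite mem_filter => /andP[pp /mapP[q _ pq]].
  by rewrite pp pq /= le_max ge_min !lexx !orbT.
have [d1 d2 d3 d4] := merge_itvsP l''P.
have l'1 : all (fun p => p.1 < p.2) l'.
  rewrite all_cat l1 all_map; apply: sub_all l1 => p /=.
  by rewrite ltrD2r.
exists (merge_itvs l''); split => //.
  apply: le_lt_trans d3 _.
  apply: (@le_lt_trans _ _ (total l')); last first.
    rewrite /total big_cat big_map /=.
    have -> : \sum_(j <- l) (j.2 + 2 * pi - (j.1 + 2 * pi)) = total l.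
      by apply: eq_bigr => p _; ring.
    by rewrite -/(total l); lra.
  rewrite /total /l'' big_filter big_map big_mkcond /=.
  rewrite !big_seq; apply: ler_sum => p pl; have := allP l'1 p pl => /= pp.
  case: ifP => _; last by lra.
  have : p.1 <= Num.max p.1 lo by rewrite le_max lexx.
  have : Num.min p.2 hi <= p.2 by rewrite ge_min lexx.
  by lra.
move=> z Kz; have z1 : nm z = 1 by apply/norm_eq1/K1.
have [s /andP[s0 s1] zs] := expi_onto t0 z1; exists s; split => //.
have sr : ~ (`|s - t0| < r) by move=> /rP; rewrite -zs.
have sr' : ~ (`|s - 2 * pi - t0| < r).
  by move=> /rP; rewrite expiB expi2pi divr1 -zs.
have {}sr : t0 + r <= s.
  by rewrite leNgt; apply/negP => h; apply: sr; rewrite ger0_norm; lra.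
have {}sr' : s <= t0 + 2 * pi - r.
  by rewrite leNgt; apply/negP => h; apply: sr'; rewrite ler0_norm; lra.
have [p pl' ps] : exists2 p, p \in l' & p.1 < s < p.2.
  have [s2|s2] := leP s (2 * pi).
    have /l3/hasP[p pl ps] : S s.
      by split; rewrite /= ?in_itv /= -?zs //; apply/andP; split; lra.
    by exists p; rewrite // mem_cat pl.
  have /l3/hasP[p pl /andP[ps1 ps2]] : S (s - 2 * pi).
    split; first by rewrite /= in_itv /=; apply/andP; split; lra.
    by rewrite /= expiB expi2pi divr1 -zs.
  exists (p.1 + 2 * pi, p.2 + 2 * pi).
    by rewrite mem_cat; apply/orP; right; apply/mapP; exists p.
  by apply/andP; split => /=; lra.
apply: d4; apply/hasP; exists (clip p).
  rewrite mem_filter map_f // andbT /= gt_max !lt_min.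
  have ppp := allP l'1 p pl'; rewrite /= in ppp; rewrite ppp /=.
  by case/andP: ps => h1 h2; apply/and3P; split; rewrite /lo /hi; lra.
rewrite /= ge_max le_min; case/andP: ps => h1 h2.
by apply/andP; split; apply/andP; split; rewrite /lo /hi; lra.
Qed.

End NullCover.

(** * Finite nets and uniform continuity on compact sets *)

Section CompactSets.
Set Implicit Arguments.
Unset Strict Implicit.
Context {R : realType}.
Local Notation C := R[i].

Lemma compact_net (A : set C) (d : C -> R) : compact A ->
  (forall z, A z -> 0 < d z) ->
  exists s : seq C, {in s, forall w, A w} /\
    forall z, A z -> exists2 w, w \in s & nm (z - w) < d w.
Proof.
move=> + d0; rewrite compact_cover => /(_ C A (fun w => ball w (d w)%:C%C)) [||D DA AD].
- by move=> w _; exact: ball_open.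
- move=> z Az; exists z => //; rewrite -ball_normE /ball_ /= subrr normr0.
  by rewrite ltcR d0.
exists (finmap.enum_fset D); split=> [w wD|z /AD[w wD]].
  by have := DA w wD; rewrite inE.
rewrite -ball_normE /ball_ /= nmE ltcR nmC => zw; exists w => //; exact: wD.
Qed.

Lemma heine (K : set C) (f : C -> C) : compact K -> {within K, continuous f} ->
  forall e : R, 0 < e -> exists2 d : R, 0 < d &
    forall z w, K z -> K w -> nm (z - w) < d -> nm (f z - f w) <= e.
Proof.
move=> cK /subspace_continuousP fc e e0.
have e2 : 0 < e / 2 by rewrite divr_gt0.
have loc z : exists d : R, K z -> 0 < d /\
    forall w, K w -> nm (w - z) < d -> nm (f w - f z) <= e / 2.
  have [Kz|nKz] := pselect (K z); last by exists 0.
  have e2C : 0 < (e / 2)%:C%C :> C by rewrite ltcR.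
  have /cvgrPdist_lt /(_ _ e2C) := fc z Kz.
  rewrite /within /= => /nbhs_ballP[d /= d0 dP].
  have dE : d = (complex.Re d)%:C%C.
    by move: d0; rewrite ltcE /= => /andP[/eqP d1 _]; case: (d) d1 => a b /= ->.
  exists (complex.Re d) => _; rewrite -ltcR -dE; split => // w Kw wz.
  have := dP w; rewrite -ball_normE /ball_ /= nmE dE ltcR (nmC z w) => /(_ wz Kw).
  by rewrite nmE ltcR nmC => /ltW.
have [d dP] := choice loc.
have d0 z : K z -> 0 < d z / 2 by move=> /dP[h _]; rewrite divr_gt0.
have [s [sK sP]] := compact_net cK d0.
have [r r0 rP] : exists2 r, 0 < r & {in s, forall w, r <= d w / 2}.
  apply: (@common_radius R _ s (fun w r => r <= d w / 2)) => [w a b ad ba|w ws].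
    exact: le_trans ad.
  by exists (d w / 2) => //; apply/d0/sK.
exists r => // z w Kz Kw zw; have [x xs zx] := sP z Kz.
have [_ h] := dP x (sK x xs); have rx := rP x xs.
have h1 := h z Kz; have h2 := h w Kw.
have {}h1 : nm (f z - f x) <= e / 2 by apply: h1; have := nm_ge0 (z - x); lra.
have {}h2 : nm (f w - f x) <= e / 2.
  by apply: h2; have := nm_tri w z x; rewrite (nmC w z); lra.
by have := nm_tri (f z) (f x) (f w); rewrite (nmC (f x)); lra.
Qed.

End CompactSets.

(** * Inner functions approximating unimodular data on a null set *)

Section NullSets.
Set Implicit Arguments.
Unset Strict Implicit.
Context {R : realType}.
Local Notation C := R[i].
Variable K : set C.
Hypothesis K_compact : compact K.
Hypothesis K_circle : K `<=` unit_circle R.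
Hypothesis K_null : arclength K = 0%E.

Let K1 z : K z -> nm z = 1.
Proof. by move=> /K_circle /norm_eq1. Qed.

Lemma peaking_inner (e : R) : 0 < e -> exists N v, inner N v /\
  forall z, K z -> nm (z * v z - 1) <= e.
Proof.
move=> e0; have pi0 := pi_gt0 R.
have [t0 [r [r0 cov]]] := null_circle_cover K_compact K_circle K_null.
(* The bound by $\pi$ is the length condition of [peaking_arcs]. *)
have [|l [l1 l2 l3 l4]] := cov (Num.min e pi); first by rewrite lt_min e0.
(* An empty cover means that $K$ is empty. *)
have [l0|l0] := eqVneq l [::].
  exists 0%N, (fun=> 1); split; first exact: inner1.
  by move=> z /l4[s []]; rewrite l0.
have [n nl] : exists n, size l = n.+1.
  by exists (size l).-1; rewrite prednK // lt0n size_eq0.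
pose p (i : 'I_n.+1) := nth (0, 0) l i.
have pl i : p i \in l by rewrite mem_nth // nl.
have /andP[al pw] := l1.
have total_l : total l = \sum_i ((p i).2 - (p i).1).
  by rewrite /total (big_nth (0, 0)) nl big_mkord.
have le_l : total l <= e /\ total l <= pi.
  by move: l3; rewrite lt_min => /andP[/ltW ? /ltW ?].
have [||||v vn vP] := @peaking_arcs R n (fun i => (p i).1) (fun i => (p i).2).
- by move=> i; have := allP al _ (pl i).
- have key i j : (i < j < n.+1)%N -> (nth (0, 0) l i).2 < (nth (0, 0) l j).1.
    move=> /andP[ij jn]; have /(pairwiseP (0, 0)) := pw; apply => //; rewrite inE nl //.
    exact: ltn_trans ij jn.
  move=> i j; rewrite neq_ltn => /orP[ij|ij]; [left|right].
    by apply: key; rewrite ij /=.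
  by apply: key; rewrite ij /=.
- move=> i j; have /andP[_ h1] := allP l2 _ (pl i).
  by have /andP[h2 _] := allP l2 _ (pl j); lra.
- by rewrite -total_l; case: le_l.
exists n, v; split => // z Kz; have [s [-> /hasP[q ql qs]]] := l4 z Kz.
have qn : (index q l < n.+1)%N by rewrite -nl index_mem.
apply: le_trans (vP (Ordinal qn) s _) _; first by rewrite /p /= nth_index.
by rewrite -total_l; case: le_l.
Qed.

Lemma nm_expB1 (a : C) n : nm a <= 1 -> nm (a ^+ n - 1) <= n%:R * nm (a - 1).
Proof.
move=> a1; rewrite subrX1 nmM mulrC ler_wpM2r ?nm_ge0 //.
apply: le_trans (nm_sum _ _ _) _; rewrite -[n in n%:R](card_ord n) -sumr_const.
by apply: ler_sum => i _; rewrite nmX exprn_ile1 ?nm_ge0.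
Qed.

Lemma conj_power_inner d (e r : R) : 0 < e -> 0 <= r -> r < 1 ->
  exists N v, [/\ inner N v, forall z, K z -> nm (z ^+ d * v z - 1) <= e
    & forall z, nm z <= r -> nm (v z) <= e].
Proof.
move=> e0 r0 r1.
have [m rm] : exists m, r ^+ m <= e.
  have r1' : `|r| < 1 by rewrite ger0_norm.
  have /cvgrPdist_lt /(_ _ e0) [m _ mP] := cvg_expr r1'.
  exists m; have := mP m (leqnn m); rewrite /= sub0r normrN => /ltW.
  by apply: le_trans; exact: ler_norm.
have n0 : 0 < (m + d).+1%:R :> R by rewrite ltr0n.
(* Raising to the power $m+d$ multiplies the error by at most $m+d$; [m] was fixed beforehand by
   [r]. *)
have [N [v [vN vP]]] := peaking_inner (divr_gt0 e0 n0).
exists (m * 1 + (m + d) * N)%N, (fun z => z ^+ m * v z ^+ (m + d)); split.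
- by apply: innerM; [exact: (innerX m inner_id) | exact: innerX].
- move=> z Kz; have z1 := K1 Kz.
  have -> : z ^+ d * (z ^+ m * v z ^+ (m + d)) = (z * v z) ^+ (m + d).
    by rewrite exprMn mulrA -exprD addnC.
  apply: le_trans (nm_expB1 _ _) _; first by rewrite nmM z1 mul1r (inner_le1 vN) ?z1.
  have := vP z Kz; rewrite ler_pdivlMr // => h; apply: le_trans h.
  by rewrite mulrC ler_wpM2l ?nm_ge0 // ler_nat.
- move=> z zr; rewrite nmM !nmX; apply: le_trans rm.
  have z1 : nm z <= 1 by apply: le_trans zr (ltW r1).
  have h1 : nm (v z) ^+ (m + d) <= 1 by rewrite exprn_ile1 ?nm_ge0 ?(inner_le1 vN).
  have h2 : nm z ^+ m <= r ^+ m by rewrite lerXn2r ?nnegrE ?nm_ge0.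
  by apply: le_trans h2; rewrite ler_piMr // exprn_ge0 ?nm_ge0.
Qed.

Lemma sin_ge (g x : R) : 0 <= g -> g <= x -> x <= pi - g -> sin g <= sin x.
Proof.
move=> g0 gx xg; have pi0 := pi_gt0 R.
have mono (y : R) : g <= y -> y <= pi / 2 -> sin g <= sin y.
  move=> gy yp; rewrite leNgt ltr_sin ?in_itv /=; first by rewrite -leNgt.
    by apply/andP; split; lra.
  by apply/andP; split; lra.
have [xp|xp] := leP x (pi / 2); first exact: mono.
have -> : sin x = sin (pi - x).
  by rewrite sinB sinpi cospi mul0r sub0r mulN1r opprK.
by apply: mono; lra.
Qed.

(** If $|t-s| \ge g$, then $|t-s|/2$ lies in $[g/2, \pi-g/2]$, where the sine is at least
    $\sin(g/2)$. The margin [r] around the cut excludes angles that are close only modulo $2\pi$. *)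
Lemma chord_ge (t0 r g s t : R) : 0 < g -> g <= r -> r <= pi ->
  t0 + r <= s <= t0 + 2 * pi - r -> t0 <= t < t0 + 2 * pi ->
  nm (expi s - expi t) < 2 * sin (g / 2) -> `|t - s| < g.
Proof.
move=> g0 gr rpi /andP[s1 s2] /andP[t1 t2]; rewrite nm_chord => h.
rewrite ltNge; apply/negP => gst.
have : sin (g / 2) <= sin (`|t - s| / 2).
  apply: sin_ge; [lra|lra|].
  have : `|t - s| <= 2 * pi - r by rewrite ler_norml; apply/andP; split; lra.
  by lra.
have le_abs : sin (`|t - s| / 2) <= `|sin ((s - t) / 2)|.
  have [ts|ts] := leP 0 (t - s); last by rewrite (ltr0_norm ts) opprB ler_norm.
  by rewrite (ger0_norm ts) (sin_halfN s t) normrN ler_norm.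
by lra.
Qed.

(* The data interpolated are constant on a neighbourhood of each of finitely
   many arcs covering K, so that the Fejer means converge uniformly on K. *)
Lemma step_fejer_approx (psi chi : C -> C) (k e : R) : 0 < e -> 0 < k ->
  (forall d : R, 0 < d -> exists2 d' : R, 0 < d' & forall z w, K z -> K w ->
    nm (z - w) < d' -> nm (psi z - psi w) <= d) ->
  (forall z, K z -> nm (psi z) = 1) ->
  (forall w, nm w = 1 -> nm (chi w) <= k) ->
  exists M N g, [/\ (0 < N)%N, (N <= M)%N, forall j, nm (g j) <= k
    & forall z, K z -> exists w, [/\ nm w = 1, nm (w - psi z) <= e
        & nm (fejer_mean M N g z - chi w) <= e]].
Proof.
move=> e0 k0 psic psi1 chik; have pi0 := pi_gt0 R.
have [t0 [r [r0 cov]]] := null_circle_cover K_compact K_circle K_null.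
have [d d0 dP] := psic e e0.
have [l [l1 l2 l3 l4]] := cov d d0.
have [g g0 gP] := disjoint_itvs_gap l1.
have /andP[al _] := l1.
have val (p : R * R) : exists w, nm w = 1 /\
    forall s, p \in l -> p.1 <= s <= p.2 -> K (expi s) -> nm (w - psi (expi s)) <= e.
  have [[s [sp Ks]]|np] := pselect (exists s, p.1 <= s <= p.2 /\ K (expi s)); last first.
    exists 1; split; first exact: nm1.
    by move=> s _ sp Ks; case: np; exists s.
  exists (psi (expi s)); split; first exact: psi1.
  move=> s' pl s'p Ks'; apply: dP => //; apply: le_lt_trans (expi_lip _ _) _.
  apply: le_lt_trans l3.
  have : p.2 - p.1 <= total l.
    rewrite /total (big_rem p) //= lerDl big_seq; apply: sumr_ge0 => q ql.
    by have := allP al q (mem_rem ql); rewrite subr_ge0 => /ltW.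
  by case/andP: sp => ? ?; case/andP: s'p => ? ? ?; rewrite ler_norml; apply/andP; split; lra.
have [W WP] := choice val.
pose g' := Num.min (g / 2) (Num.min r pi).
have g'0 : 0 < g' by rewrite !lt_min divr_gt0 // r0 pi0.
have [g'g g'r g'pi] : [/\ g' <= g / 2, g' <= r & g' <= pi].
  by rewrite /g' !ge_min !lexx ?orbT.
(* As [g'] is at most half the gap, the enlarged arcs are disjoint: an angle near an arc finds it as
   the first whose enlarged right end exceeds the angle. *)
pose arc t := nth (0, 0) l (find (fun p => t < p.2 + g') l).
have arcP p s t : p \in l -> p.1 <= s <= p.2 -> `|t - s| < g' -> arc t = p.
  rewrite /arc => + /andP[ps1 ps2]; rewrite ltr_norml => + /andP[ts1 ts2].
  elim: (l) gP al => [|q l' IHl] //= /andP[qg l'g] /andP[qq al'].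
  rewrite inE => /predU1P[<-|pl']; first by rewrite ifT //; lra.
  have := allP qg p pl' => /= h; rewrite ifF; first exact: IHl.
  by apply/negbTE; rewrite -leNgt; lra.
pose q := 2 * sin (g' / 2).
have q0 : 0 < q by rewrite mulr_gt0 // sin_half_gt0 //; lra.
have qq : 0 < e * q ^+ 2 by rewrite mulr_gt0 // exprn_gt0.
pose N := (Num.truncn (8 * k / (e * q ^+ 2))).+1.
have N0 : (0 < N)%N by [].
have NP : 8 * k / (N%:R * q ^+ 2) <= e.
  have := ltW (truncnS_gt (8 * k / (e * q ^+ 2))).
  rewrite -/N ler_pdivrMr // ler_pdivrMr; last by rewrite mulr_gt0 ?ltr0n ?exprn_gt0.
  by rewrite mulrCA.
clearbody N.
(* The smallest number of nodes for which the kernel has mean 1. *)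
pose M := N.
have node j : exists t, t0 <= t < t0 + 2 * pi /\ unity_root M ^+ j = expi t.
  have u1 : nm (unity_root M ^+ j : C) = 1 by rewrite nmX nm_unity expr1n.
  by have [t h1 h2] := expi_onto t0 u1; exists t.
have [T TP] := choice node.
exists M, N, (fun j => chi (W (arc (T j)))); split=> // [j|z Kz].
  by apply: chik; have [] := WP (arc (T j)).
have [s [zs /hasP[p pl ps]]] := l4 z Kz.
have [w1 wP] := WP p; exists (W p); split=> //.
  by rewrite zs; apply: wP => //; rewrite -zs.
rewrite -[e]add0r; apply: le_trans (_ : 0 + 8 * k / (N%:R * q ^+ 2) <= _); last first.
  by rewrite lerD2l.
apply: fejer_mean_approx => //; first exact: K1.
- exact: chik.
- by move=> j _; apply: chik; have [] := WP (arc (T j)).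
move=> j _ zj; have [Tj1 Tj2] := TP j.
have sl : t0 + r <= s <= t0 + 2 * pi - r.
  have /andP[h1 h2] := allP l2 p pl; case/andP: ps => ps1 ps2.
  by apply/andP; split; lra.
rewrite (arcP p s) ?subrr ?nm0 //.
by apply: (@chord_ge t0 g' g') => //; [case/andP: sl => ? ?; apply/andP; split; lra | rewrite -zs -Tj2].
Qed.

(** With the angle $t$ in $[-\pi,\pi)$, $\cos(t/2) \ge 0$ gives $\cos^2(t/4) \ge 1/2$. *)
Lemma small_root (w : C) : nm w = 1 -> exists c : C, [/\ nm c = 1, c ^+ 4 = w & 1 / 2 <= complex.Re c].
Proof.
move=> /(expi_onto (- pi))[t /andP[t1 t2] ->]; have pi0 := pi_gt0 R.
exists (expi (t / 4)); split; first exact: nm_expi.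
  by rewrite expiX; congr expi; field.
rewrite /=; have c0 : 0 <= cos (t / 4) by apply: cos_ge0_pihalf; apply/andP; split; lra.
have : 0 <= cos (t / 4 *+ 2).
  by apply: cos_ge0_pihalf; rewrite -mulr_natr; apply/andP; split; lra.
rewrite cos_mulr2n; nra.
Qed.

(* For a = 1 and 1 + t = c / 2 one has (t + 1) / (t^* + 1) = c / c^* = c^2. *)
Lemma mobius_square_approx (a c t : C) (e : R) : nm a = 1 -> nm c = 1 ->
  nm t <= 7 / 8 -> nm (a - 1) <= e -> nm (t - (c / 2 - 1)) <= e ->
  nm ((a * (t + a) / (1 + conjc t * a)) ^+ 2 - c ^+ 4) <= 544 * e.
Proof.
move=> a1 c1 tk ae te; have e0 := le_trans (nm_ge0 _) ae; have c0 := unit_neq0 c1.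
have den (x : C) : nm x = 1 -> 1 / 8 <= nm (1 + conjc t * x).
  move=> x1; have := nm_le_sub 1 (1 + conjc t * x).
  by rewrite nm1 opprD addNKr nmN nmM nm_conj x1 mulr1; lra.
have d1 := den a a1; have := den 1 nm1; rewrite mulr1 => d2.
have n1 : 1 + conjc t * a != 0 by rewrite -nm_gt0; lra.
have n2 : 1 + conjc t != 0 by rewrite -nm_gt0; lra.
set V := a * (t + a) / (1 + conjc t * a).
have V1 : nm V = 1.
  have tD : conjc (1 + conjc t * a) = 1 + t / a.
    have cD (x : C) : conjc (1 + x) = 1 + conjc x.
      by case: x => u v; apply/eqP; rewrite eq_complex /= !add0r !eqxx.
    by rewrite cD conjcM conjcK (conj_unit a1).
  have -> : V = a ^+ 2 * (conjc (1 + conjc t * a) / (1 + conjc t * a)).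
    by rewrite tD /V; field; rewrite n1 (unit_neq0 a1).
  by rewrite nmM nmX a1 expr1n mul1r nm_div nm_conj divff // nm0_eq0.
(* Both denominators are at least $1/8$: $256 = 4\cdot 8^2$ here and $16 = 2\cdot 8$ in [s2]; the
   final difference of squares doubles the sum 272. *)
have s1 : nm (V - (1 + t) / (1 + conjc t)) <= 256 * e.
  have -> : V - (1 + t) / (1 + conjc t) =
      (a - 1) * (t + a + 1 + conjc t * a) / ((1 + conjc t * a) * (1 + conjc t)).
    by rewrite /V; field; rewrite n1 n2.
  rewrite nm_div !nmM ler_pdivrMr ?mulr_gt0 ?nm_gt0 //.
  have k1 : nm (t + a + 1 + conjc t * a) <= 4.
    apply: le_trans (nmD _ _) _; rewrite nmM nm_conj a1 mulr1.
    by have := nmD (t + a) 1; have := nmD t a; rewrite nm1 a1; lra.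
  have k2 : 1 / 64 <= nm (1 + conjc t * a) * nm (1 + conjc t) by nra.
  apply: (@le_trans _ _ (e * 4)); first by apply: ler_pM; rewrite ?nm_ge0.
  have -> : e * 4 = 256 * e * (1 / 64) by field.
  exact: (ler_wpM2l (mulr_ge0 (ler0n _ 256) e0) k2).
have s2 : nm ((1 + t) / (1 + conjc t) - c ^+ 2) <= 16 * e.
  set eta := t - (c / 2 - 1) in te.
  have half : conjc (2^-1 : C) = 2^-1 by rewrite conjc_inv conjc_nat.
  have etaC : conjc eta = conjc t - (c^-1 / 2 - 1).
    by rewrite /eta (conjcB t) (conjcB (c / 2)) (conjcM c) half conjc1 (conj_unit c1).
  have -> : (1 + t) / (1 + conjc t) - c ^+ 2 =
      (eta * c^-1 - c * conjc eta) / ((1 + conjc t) * c^-1).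
    by rewrite etaC /eta; field; rewrite n2 c0.
  rewrite nm_div nmM nmV c1 invr1 mulr1 ler_pdivrMr ?nm_gt0 //.
  apply: le_trans (nmB _ _) _; rewrite !nmM nmV nm_conj c1 invr1 mulr1 mul1r.
  by apply: le_trans (lerD te te) _; nra.
have s3 : nm (V - c ^+ 2) <= 272 * e.
  by apply: le_trans (nm_tri _ ((1 + t) / (1 + conjc t)) _) _; lra.
have -> : V ^+ 2 - c ^+ 4 = (V - c ^+ 2) * (V + c ^+ 2) by ring.
rewrite nmM; apply: (@le_trans _ _ (272 * e * 2)); last by lra.
apply: ler_pM; rewrite ?nm_ge0 //; apply: le_trans (nmD _ _) _.
by rewrite V1 nmX c1 expr1n.
Qed.

Lemma unimodular_inner (psi : C -> C) (e r : R) : 0 < e -> 0 <= r -> r < 1 ->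
  (forall d : R, 0 < d -> exists2 d' : R, 0 < d' & forall z w, K z -> K w ->
    nm (z - w) < d' -> nm (psi z - psi w) <= d) ->
  (forall z, K z -> nm (psi z) = 1) ->
  exists N v, [/\ inner N v, forall z, K z -> nm (v z - psi z) <= e
    & forall z, nm z <= r -> nm (v z) <= e].
Proof.
(* 600 leaves room for 544 from the Möbius quotient and 1 from freezing. *)
move=> e0 r0 r1 psic psi1; have [e1 e10 eE] : exists2 e1, 0 < e1 & e = 600 * e1 by exists (e / 600); lra.
have e1e : e1 <= e by lra.
have rootP' (w : C) : exists c : C, nm w = 1 ->
    [/\ nm c = 1, c ^+ 4 = w & 1 / 2 <= complex.Re c].
  have [/small_root[c cP]|w1] := pselect (nm w = 1); first by exists c.
  by exists 0.
have [c cP] := choice rootP'.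
pose chi w := c w / 2 - 1.
(* $|c/2-1|^2 = 5/4-\mathrm{Re}\,c \le 3/4 < (7/8)^2$. *)
have chik w : nm w = 1 -> nm (chi w) <= 7 / 8.
  move=> /cP[c1 _ cr]; have -> : chi w = (c w - 2) / 2 by rewrite /chi; field.
  rewrite nm_div nm_nat ler_pdivrMr // -(@ler_pXn2r _ 2) ?nnegrE ?nm_ge0 ?mulr_ge0 ?divr_ge0 //.
  have := nm_sq (c w); rewrite c1 expr1n nm_sq; case: (c w) cr => a b /= cr h.
  by nra.
have [M [N [g [N0 NM gk gP]]]] := step_fejer_approx e10 (ltac:(lra) : 0 < 7 / 8 :> R) psic psi1 chik.
pose tau := fejer_mean M N g.
have tauk z : nm z = 1 -> nm (tau z) <= 7 / 8.
  by move=> z1; apply: fejer_mean_bound => // j _; exact: gk.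
have tauC z : conjc (tau z) = fejer_mean M N (fun j => conjc (g j)) z.
  rewrite /tau /fejer_mean conjcM conjc_inv conjc_nat rmorph_sum /=.
  by congr (_ * _); apply: eq_bigr => j _; rewrite conjcM conjc_real.
have [q qE] := fejer_mean_poly M N g.
have [h hE] := fejer_mean_poly M N (fun j => conjc (g j)).
have qk z : nm z = 1 -> nm q.[z] <= 7 / 8.
  by move=> z1; rewrite qE // nmM nmX z1 expr1n mul1r tauk.
have hq z : nm z = 1 -> h.[z] = z ^+ (N + N) * conjc q.[z].
  move=> z1; rewrite hE // qE // conjcM conjcX (conj_unit z1) tauC exprD exprVn.
  by field; rewrite expf_neq0 ?unit_neq0.
have [N1 [v1 [v1N v1K v1r]]] := conj_power_inner N e10 r0 r1.
have [BN hk den] := inner_mobius v1N (ltac:(lra) : 7 / 8 < 1 :> R) qk hq.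
set B := (fun z => _ / _) in BN.
(* The factor [v1] serves twice: on $K$ it compensates the $z^N$ that cleared the poles of the Fejér
   mean, and it is small for $|z| \le r$. *)
pose V z := v1 z * B z.
have VN : inner (N1 + (N1 + (N + N))) V := innerM v1N BN.
exists (2 * (N1 + (N1 + (N + N))))%N, (fun z => V z ^+ 2); split.
- exact: innerX.
- move=> z Kz; have z1 := K1 Kz; have [w [w1 wpsi wtau]] := gP z Kz.
  have [c1 c4 cr] := cP w w1.
  pose a := z ^+ N * v1 z.
  have a1 : nm a = 1 by rewrite nmM nmX z1 expr1n mul1r (inner_circle v1N).
  have VE : V z = a * (tau z + a) / (1 + conjc (tau z) * a).
    rewrite /V /B qE // hE // -tauC -/(tau z) /a exprD.
    have -> : 1 + z ^+ N * conjc (tau z) * v1 z = 1 + conjc (tau z) * (z ^+ N * v1 z).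
      by ring.
    by ring.
  have := mobius_square_approx a1 c1 (tauk z z1) (v1K z Kz) wtau.
  rewrite -VE c4 => Vw; apply: le_trans (nm_tri _ w _) _.
  by apply: le_trans (lerD Vw wpsi) _; rewrite eE; lra.
- move=> z zr; have z1 : nm z <= 1 by apply: le_trans zr (ltW r1).
  rewrite nmX; have := v1r z zr; have := inner_le1 BN z1; have := nm_ge0 (B z).
  have := nm_ge0 (v1 z); rewrite /V nmM expr2.
  have := inner_le1 v1N z1.
  move: (nm (v1 z)) (nm (B z)) => x y h1 h2 h3 h4 h5.
  have xy1 : x * y <= 1 by nra.
  have xye : x * y <= e1 by nra.
  have xy0 : 0 <= x * y by nra.
  by nra.
Qed.

End NullSets.

(** * Approximation on a compact subset of the disc, and stability of Möbius quotients *)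

Section FinalApproximation.
Set Implicit Arguments.
Unset Strict Implicit.
Context {R : realType}.
Local Notation C := R[i].
Implicit Types (K L : set C) (f : C -> C).

Lemma supnorm_lt (E : set C) f (a e : R) : 0 < e -> a < e ->
  (forall z, E z -> nm (f z) <= a) -> (supnorm E f < e%:E)%E.
Proof.
move=> e0 ae fa; rewrite /supnorm gt_max lte_fin e0 /=.
apply: le_lt_trans (_ : (a%:E < e%:E)%E); last by rewrite lte_fin.
by apply: ge_ereal_sup => _ [z Ez <-]; rewrite lee_fin fa.
Qed.

Lemma supnorm_le (E : set C) f (a : R) z : (supnorm E f <= a%:E)%E -> E z ->
  nm (f z) <= a.
Proof.
rewrite /supnorm ge_max => /andP[_ h] Ez; rewrite -lee_fin; apply: le_trans h.
by apply: ereal_sup_ubound; exists z.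
Qed.

Lemma compact_disc_radius L : compact L -> L `<=` unit_disc R ->
  exists2 r : R, 0 < r < 1 & forall z, L z -> nm z <= r.
Proof.
move=> cL L1; have L1' z : L z -> 0 < (1 - nm z) / 2.
  by move=> /L1; rewrite /unit_disc /= norm_lt1 => h; lra.
have [s [sL sP]] := compact_net cL L1'.
have [d d0 dP] : exists2 d, 0 < d & {in s, forall w, d <= (1 - nm w) / 2}.
  apply: (@common_radius R _ s (fun w d => d <= (1 - nm w) / 2)) => [w a b ad ba|w ws].
    exact: le_trans ad.
  by exists ((1 - nm w) / 2) => //; apply/L1'/sL.
exists (Num.max (1 / 2) (1 - d)); first by rewrite lt_max gt_max; apply/andP; split; [apply/orP; left|apply/andP; split]; lra.
move=> z /sP[w ws zw]; rewrite le_max; apply/orP; right.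
by have := dP w ws; have := nm_le_sub z w; lra.
Qed.

(** A net reduces $L$ to finitely many points. The polynomial depends on the net, but its bound 2 on
    the circle does not, so a Lipschitz constant is known before the mesh is chosen. *)
Lemma schur_poly_compact L f (e : R) : compact L -> L `<=` unit_disc R ->
  (forall z, nm z < 1 -> derivable f z 1) ->
  (forall z, nm z < 1 -> nm (f z) <= 1) -> 0 < e ->
  exists p : {poly C}, (forall z, nm z = 1 -> nm p.[z] <= 1 + e) /\
    forall z, L z -> nm (p.[z] - f z) <= e.
Proof.
move=> cL L1 fd f1 e0; have [r /andP[r0 r1] Lr] := compact_disc_radius cL L1.
(* Four errors of size [e1] are added at the end; the cap at 1 gives the bound 2. *)
pose e1 := Num.min 1 (e / 4).
have e10 : 0 < e1 by rewrite lt_min ltr01 divr_gt0.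
have [e11 e1e] : e1 <= 1 /\ e1 <= e / 4 by rewrite !ge_min !lexx orbT.
pose q := (1 - r) / 2; have q0 : 0 < q by rewrite divr_gt0 // subr_gt0.
(* 4 / (1 - (1 + r) / 2) is the Lipschitz constant of a polynomial bounded by 2
   on the circle *)
pose eta := e1 * q / 8; have eta0 : 0 < eta by rewrite divr_gt0 // mulr_gt0.
have loc z : exists d, L z -> [/\ 0 < d, d <= eta, d <= q & forall w, nm (w - z) < d -> nm (f w - f z) <= e1].
  have [Lz|nL] := pselect (L z); last by exists 0.
  have z1 : nm z < 1 by apply: le_lt_trans (Lr z Lz) r1.
  have [d d0 dP] := cdiff_cont (derivable_cdiff (fd z z1)) e10.
  exists (Num.min d (Num.min eta q)) => _; split; rewrite ?lt_min ?ge_min ?d0 ?eta0 ?q0 ?lexx ?orbT //.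
  by move=> w; rewrite lt_min => /andP[/dP].
have [d dP] := choice loc.
have dpos z : L z -> 0 < d z by case/dP.
have [s [sL sP]] := compact_net cL dpos.
(* The point 0, excluded from [schur_poly_approx], is moved by less than its net radius. *)
pose nz z := if z == 0 then (d z / 2)%:C%C else z : C.
have nzP z : L z -> [/\ nz z != 0, nm (nz z - z) < d z & nm (nz z) <= (1 + r) / 2].
  move=> Lz; have [d0 _ dq _] := dP z Lz; rewrite /nz; have [zE|z0] := eqVneq z 0.
    have d20 : 0 < d z / 2 by rewrite divr_gt0.
    rewrite [X in _ - X]zE subr0 -nm_gt0 nm_real gtr0_norm //; split=> //; first by lra.
    by rewrite /q in dq; lra.
  by split=> //; rewrite ?subrr ?nm0 //; have := Lr z Lz; lra.
have s1 : {in map nz s, forall z, z != 0 /\ nm z < 1}.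
  move=> _ /mapP[w ws ->]; have [h1 _ h2] := nzP w (sL w ws); split=> //.
  by lra.
have [p [p1 pf]] := schur_poly_approx fd f1 e10 s1.
exists p; split=> [z z1|z Lz]; first by apply: le_trans (p1 z z1) _; lra.
have [w ws zw] := sP z Lz; have Lw := sL w ws.
have [w0 wd wr] := nzP w Lw; have [d0 deta dq fw] := dP w Lw.
have zn1 : nm z <= 1 by apply: le_trans (Lr z Lz) (ltW r1).
have r1' : (1 + r) / 2 < 1 by lra.
have p2 x : nm x = 1 -> nm p.[x] <= 2 by move=> /p1; lra.
have := poly_schwarz r1' p2 zn1 wr.
have -> : 1 - (1 + r) / 2 = q by rewrite /q; field.
have zs : nm (z - nz w) <= 2 * eta.
  by have := nm_tri z w (nz w); rewrite (nmC w); lra.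
have k1 : 2 * 2 / q * nm (z - nz w) <= e1.
  have -> : e1 = 2 * 2 / q * (2 * eta) by rewrite /eta; field; rewrite gt_eqF.
  by rewrite ler_wpM2l // divr_ge0 ?ltW // mulr_gt0.
have k2 := pf _ (map_f nz ws).
have k3 := fw _ wd; have k4 := fw _ zw.
have := nm_tri p.[z] p.[nz w] (f z); have := nm_tri p.[nz w] (f (nz w)) (f z).
have := nm_tri (f (nz w)) (f w) (f z); rewrite (nmC (f w) (f z)).
lra.
Qed.

(* w |-> (g + w) / (1 + g^* w) is an automorphism of the disc. *)
Lemma mobius_lip (g a b : C) (k : R) : nm g <= k -> k < 1 -> nm a = 1 -> nm b = 1 ->
  nm ((g + a) / (1 + conjc g * a) - (g + b) / (1 + conjc g * b)) <= nm (a - b) / (1 - k) ^+ 2.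
Proof.
move=> gk k1 a1 b1.
have den x : nm x = 1 -> 1 - k <= nm (1 + conjc g * x).
  move=> x1; have := nm_le_sub 1 (1 + conjc g * x).
  by rewrite nm1 opprD addNKr nmN nmM nm_conj x1 mulr1; lra.
have k0 : 0 < 1 - k by lra.
have da : 1 + conjc g * a != 0 by rewrite -nm_gt0 (lt_le_trans k0) // den.
have db : 1 + conjc g * b != 0 by rewrite -nm_gt0 (lt_le_trans k0) // den.
have -> : (g + a) / (1 + conjc g * a) - (g + b) / (1 + conjc g * b) =
    (1 - g * conjc g) * (a - b) / ((1 + conjc g * a) * (1 + conjc g * b)).
  by field; rewrite da db.
rewrite nm_div !nmM ler_pdivrMr ?mulr_gt0 ?nm_gt0 // mulrAC.
rewrite ler_pdivlMr ?exprn_gt0 //.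
have h1 : nm (1 - g * conjc g) <= 1.
  have gg : nm g ^+ 2 <= 1 by rewrite exprn_ile1 ?nm_ge0 // (le_trans gk) // ltW.
  have -> : 1 - g * conjc g = (1 - nm g ^+ 2)%:C%C by rewrite mul_conj rmorphB rmorph1.
  rewrite nm_real ger0_norm ?subr_ge0 // gerBl.
  by rewrite exprn_ge0 // nm_ge0.
have h2 : (1 - k) ^+ 2 <= nm (1 + conjc g * a) * nm (1 + conjc g * b).
  by rewrite expr2; apply: ler_pM; rewrite ?(ltW k0) ?den.
have h3 : nm (1 - g * conjc g) * nm (a - b) <= nm (a - b) by rewrite ler_piMl ?nm_ge0.
by apply: ler_pM => //; rewrite ?mulr_ge0 ?nm_ge0 ?exprn_ge0 ?(ltW k0).
Qed.

(** The difference equals $(x-gh)v/(1+hv)$, and $|x-gh| \le 2$. *)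
Lemma mobius_near (g h v x : C) (d e : R) : nm x <= 1 -> nm g <= 1 -> nm h <= 1 ->
  0 < d -> d <= nm (1 + h * v) -> nm v <= d * e ->
  nm ((g + x * v) / (1 + h * v) - g) <= 2 * e.
Proof.
move=> x1 g1 h1 d0 dh vde; have n0 : 0 < nm (1 + h * v) by apply: lt_le_trans dh.
have -> : (g + x * v) / (1 + h * v) - g = (x - g * h) * v / (1 + h * v).
  by field; rewrite -nm_gt0.
rewrite nm_div ler_pdivrMr // nmM; have v0 := nm_ge0 v.
have xgh : nm (x - g * h) <= 2.
  by apply: le_trans (nmB _ _) _; rewrite nmM; have := nm_ge0 g; have := nm_ge0 h; nra.
apply: (@le_trans _ _ (2 * (d * e))); first by apply: ler_pM; rewrite ?nm_ge0.
have e0 : 0 <= e by rewrite -(pmulr_rge0 e d0) (le_trans v0).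
by rewrite -mulrA ler_wpM2l // mulrC ler_wpM2l.
Qed.

(** The form of continuity consumed by [unimodular_inner]; [heine] supplies it for [phi]. *)
Definition ucont K f := forall e : R, 0 < e -> exists2 d : R, 0 < d &
  forall z w, K z -> K w -> nm (z - w) < d -> nm (f z - f w) <= e.

Lemma ucontD K f g : ucont K f -> ucont K g -> ucont K (fun z => f z + g z).
Proof.
move=> fc gc e e0; have e20 : 0 < e / 2 by rewrite divr_gt0.
have [d1 d10 h1] := fc _ e20; have [d2 d20 h2] := gc _ e20.
exists (Num.min d1 d2); rewrite ?lt_min ?d10 // => z w Kz Kw.
rewrite lt_min => /andP[/(h1 z w Kz Kw) k1 /(h2 z w Kz Kw) k2].
have -> : f z + g z - (f w + g w) = (f z - f w) + (g z - g w) by ring.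
by apply: le_trans (nmD _ _) _; lra.
Qed.

Lemma ucontM K f g (a : R) : (forall z, K z -> nm (f z) <= a) ->
  (forall z, K z -> nm (g z) <= a) -> ucont K f -> ucont K g ->
  ucont K (fun z => f z * g z).
Proof.
move=> fa ga fc gc e e0; pose b := 2 * (`|a| + 1).
have b0 : 0 < b by rewrite mulr_gt0 // ltr_wpDl.
have ab : a <= b / 2 by rewrite /b; have := ler_norm a; lra.
have ea0 : 0 < e / b by rewrite divr_gt0.
have [d1 d10 h1] := fc _ ea0; have [d2 d20 h2] := gc _ ea0.
exists (Num.min d1 d2); rewrite ?lt_min ?d10 // => z w Kz Kw.
rewrite lt_min => /andP[/(h1 z w Kz Kw) k1 /(h2 z w Kz Kw) k2].
have -> : f z * g z - f w * g w = (f z - f w) * g z + f w * (g z - g w) by ring.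
apply: le_trans (nmD _ _) _; rewrite !nmM.
have half x y : 0 <= x -> 0 <= y -> x <= e / b -> y <= a -> x * y <= e / 2.
  move=> x0 y0 xe ya; have -> : e / 2 = e / b * (b / 2) by field; rewrite gt_eqF.
  by apply: ler_pM => //; lra.
have := half _ _ (nm_ge0 _) (nm_ge0 _) k1 (ga z Kz).
have := half _ _ (nm_ge0 _) (nm_ge0 _) k2 (fa w Kw).
by rewrite (mulrC (nm (f w))); lra.
Qed.

Lemma ucont_conj K f : ucont K f -> ucont K (fun z => conjc (f z)).
Proof.
move=> fc e e0; have [d d0 h] := fc e e0; exists d => // z w Kz Kw zw.
by rewrite -conjcB nm_conj h.
Qed.

Lemma ucontV K f (a : R) : 0 < a -> (forall z, K z -> a <= nm (f z)) -> ucont K f ->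
  ucont K (fun z => (f z)^-1).
Proof.
move=> a0 fa fc e e0; have ea0 : 0 < e * a ^+ 2 by rewrite mulr_gt0 ?exprn_gt0.
have [d d0 h] := fc _ ea0; exists d => // z w Kz Kw zw.
have fz0 : 0 < nm (f z) by apply: lt_le_trans (fa z Kz).
have fw0 : 0 < nm (f w) by apply: lt_le_trans (fa w Kw).
have -> : (f z)^-1 - (f w)^-1 = (f w - f z) / (f z * f w).
  by field; rewrite -!nm_gt0 fz0 fw0.
rewrite nm_div nmM ler_pdivrMr ?mulr_gt0 // nmC; apply: le_trans (h z w Kz Kw zw) _.
rewrite ler_pM2l // expr2.
by apply: ler_pM; [exact: ltW|exact: ltW|exact: fa|exact: fa].
Qed.

Lemma ucont_poly K (p : {poly C}) : (forall z, K z -> nm z <= 1) -> ucont K (horner p).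
Proof.
move=> K1; elim/poly_ind: p => [|p c IHp] e e0.
  by exists 1 => // z w _ _ _; rewrite !horner0 subrr nm0 ltW.
pose a := Num.max 1 (\sum_(i < size p) nm p`_i).
have idc : ucont K id by move=> d d0; exists d => // z w _ _ /ltW.
have pa z : K z -> nm p.[z] <= a.
  by move=> /K1 /(nm_horner_le p); rewrite le_max orbC => ->.
have za z : K z -> nm z <= a by move=> /K1; rewrite le_max => ->.
have [d d0 h] := ucontM pa za IHp idc e0.
exists d => // z w Kz Kw zw; rewrite !hornerMXaddC opprD addrACA subrr addr0.
exact: h.
Qed.

End FinalApproximation.

(** * Assembly of the Blaschke product *)

Theorem theorem2p1 (R : realType) (K L : set R[i])
    (phi f : R[i] -> R[i]) (eps : R)
    (K_compact : compact K) (K_circle : K `<=` unit_circle R)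
    (K_null : arclength K = 0%E)
    (L_compact : compact L) (L_disc : L `<=` unit_disc R)
    (phi_cont : {within K, continuous phi})
    (phi_unimodular : forall z, K z -> `|phi z| = 1)
    (f_holo : holomorphic_on (unit_disc R) f)
    (f_le1 : (supnorm (unit_disc R) f <= 1)%E)
    (eps_gt0 : 0 < eps) :
  exists B : R[i] -> R[i],
    [/\ finite_blaschke B,
        (supnorm K (B \- phi)%R < eps%:E)%E
      & (supnorm L (B \- f)%R < eps%:E)%E].
Proof.
have fd z : nm z < 1 -> derivable f z 1.
  by move=> z1; apply: f_holo; rewrite /unit_disc /= norm_lt1.
have f1 z : nm z < 1 -> nm (f z) <= 1.
  by move=> z1; apply: supnorm_le f_le1 _; rewrite /unit_disc /= norm_lt1.
have K1 z : K z -> nm z = 1 by move=> /K_circle /norm_eq1.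
have phi1 z : K z -> nm (phi z) = 1 by move=> /phi_unimodular /norm_eq1.
have [r /andP[r0 r1] Lr] := compact_disc_radius L_compact L_disc.
(* The final errors are $e$ on $K$ and $2e+3e$ on $L$. *)
have [e [e0 e1 ee]] : exists e : R, [/\ 0 < e, e <= 1 / 2 & 8 * e <= eps].
  exists (Num.min (1 / 2) (eps / 8)); split.
  - by rewrite lt_min; apply/andP; split; lra.
  - by rewrite ge_min lexx.
  - have : Num.min (1 / 2) (eps / 8) <= eps / 8 by rewrite ge_min lexx orbT.
    by lra.
have [p [p1 pf]] := schur_poly_compact L_compact L_disc fd f1 e0.
(* Rescaling brings the circle bound $1+e$ down to $1-e$, so that Möbius denominators are at least
   $e$; it moves $p$ by at most $2e$ on the disc. *)
pose g : {poly R[i]} := ((1 - e) / (1 + e))%:C%C *: p.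
have gE z : g.[z] = ((1 - e) / (1 + e))%:C%C * p.[z] by rewrite hornerZ.
have ratio0 : 0 <= (1 - e) / (1 + e) by rewrite divr_ge0 //; lra.
have gk z : nm z = 1 -> nm g.[z] <= 1 - e.
  move=> /p1 h; rewrite gE nmM nm_real ger0_norm //.
  apply: (@le_trans _ _ ((1 - e) / (1 + e) * (1 + e))); first by rewrite ler_wpM2l.
  by rewrite divfK // gt_eqF //; lra.
have k1 : 1 - e < 1 by lra.
have pmax := poly_max_principle p1.
have gf z : L z -> nm (g.[z] - f z) <= 3 * e.
  move=> Lz; have z1 : nm z <= 1 by apply: le_trans (Lr z Lz) (ltW r1).
  have : nm (g.[z] - p.[z]) <= 2 * e.
    have -> : g.[z] - p.[z] = (- (2 * e / (1 + e)))%:C%C * p.[z].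
      rewrite gE -{2}[p.[z]]mul1r -mulrBl; congr (_ * _).
      have -> : - (2 * e / (1 + e)) = (1 - e) / (1 + e) - 1.
        by field; rewrite gt_eqF //; lra.
      by rewrite rmorphB rmorph1.
    rewrite nmM nm_real normrN ger0_norm; last by rewrite divr_ge0 //; lra.
    apply: (@le_trans _ _ (2 * e / (1 + e) * (1 + e))); last first.
      by rewrite divfK // gt_eqF //; lra.
    by rewrite ler_wpM2l ?pmax // divr_ge0 //; lra.
  by have := pf z Lz; have := nm_tri g.[z] p.[z] (f z); lra.
(* Exceeding the degree makes $z^d\bar g$ a polynomial on the circle; positivity of [d] gives the
   product at least one factor. *)
pose d := (size g).+1.
pose h : {poly R[i]} := \sum_(i < size g) conjc g`_i *: 'X^(d - i).
have hE z : nm z = 1 -> h.[z] = z ^+ d * conjc g.[z].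
  move=> z1; rewrite horner_sum [in RHS]horner_coef rmorph_sum mulr_sumr /=.
  apply: eq_bigr => i _; rewrite hornerZ hornerXn conjcM conjcX (conj_unit z1) mulrCA.
  by rewrite exprVn expf_sub ?unit_neq0 // /d ltnW // ltnS ltnW.
have d0 : (0 < d)%N by [].
clearbody d h.
(* The unimodular solution of $(g+a)/(1+\bar g a) = \varphi$ on $K$. *)
pose a z := (phi z - g.[z]) / (1 - conjc g.[z] * phi z).
have den z : K z -> e <= nm (1 - conjc g.[z] * phi z).
  move=> Kz; have := nm_le_sub 1 (1 - conjc g.[z] * phi z).
  rewrite subKr nm1 nmM nm_conj phi1 // mulr1.
  by have := gk z (K1 z Kz); lra.
have den0 z : K z -> 1 - conjc g.[z] * phi z != 0.
  by move=> /den; rewrite -nm_gt0; apply: lt_le_trans.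
have a1 z : K z -> nm (a z) = 1.
  move=> Kz; have pz := phi1 z Kz; have p0 := unit_neq0 pz.
  rewrite nm_div.
  have -> : nm (phi z - g.[z]) = nm (1 - conjc g.[z] * phi z).
    have -> : phi z - g.[z] = phi z * conjc (1 - conjc g.[z] * phi z).
      by rewrite conjcB conjcM conjcK conjc1 (conj_unit pz); field.
    by rewrite nmM nm_conj pz mul1r.
  by rewrite divff // nm0_eq0 den0.
pose psi z := conjc z ^+ d * a z.
have psi1 z : K z -> nm (psi z) = 1.
  by move=> Kz; rewrite nmM nmX nm_conj K1 // expr1n mul1r a1.
have K1' z : K z -> nm z <= 1 by move=> /K1->.
have phiu : ucont K phi by exact: heine.
have psiu : ucont K psi.
  have gu : ucont K (horner g) by exact: ucont_poly.
  have cu : ucont K (fun z => conjc z ^+ d).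
    have := ucont_conj (@ucont_poly R K 'X^d K1') => Xu e' e'0.
    have [d' d'0 dP] := Xu e' e'0; exists d' => // z w Kz Kw zw.
    by have := dP z w Kz Kw zw; rewrite !hornerXn !conjcX.
  have negu (u : R[i] -> R[i]) : ucont K u -> ucont K (fun z => - u z).
    move=> uu e' e'0; have [d' d'0 dP] := uu e' e'0; exists d' => // z w Kz Kw zw.
    by rewrite -opprD nmN dP.
  have gle z : K z -> nm g.[z] <= 1.
    by move=> /K1 /gk; lra.
  have cgle z : K z -> nm (conjc g.[z]) <= 1 by rewrite nm_conj; exact: gle.
  have phile z : K z -> nm (phi z) <= 1 by move=> /phi1->.
  have nu : ucont K (fun z => phi z - g.[z]) by apply: ucontD => //; exact: negu.
  have oneu : ucont K (fun=> 1).
    by move=> e' e'0; exists 1 => // z w _ _ _; rewrite subrr nm0 ltW.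
  have du : ucont K (fun z => 1 - conjc g.[z] * phi z).
    apply: ucontD => //; apply: negu.
    by apply: (ucontM cgle phile) => //; exact: ucont_conj.
  have au : ucont K a.
    have nle z : K z -> nm (phi z - g.[z]) <= 2 + e^-1.
      move=> Kz; have := gle z Kz; have := phile z Kz.
      have := nmB (phi z) g.[z]; have : 0 < e^-1 by rewrite invr_gt0.
      lra.
    have dle z : K z -> nm (1 - conjc g.[z] * phi z)^-1 <= 2 + e^-1.
      move=> Kz; rewrite nmV; have := den z Kz; rewrite -lef_pV2 ?posrE ?nm_gt0 ?den0 //.
      lra.
    by apply: (ucontM nle dle) => //; exact: ucontV e0 den du.
  apply: (@ucontM R K _ _ 1) => // z Kz; last by rewrite a1.
  by rewrite nmX nm_conj K1 // expr1n.
(* On $K$, [mobius_lip] loses a factor $(1-k)^{-2} = e^{-2}$; on $L$, [mobius_near] requires $|v|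
   \le e\cdot e$. *)
have e3 : 0 < e ^+ 3 by rewrite exprn_gt0.
have [N [v [vN vK vL]]] := unimodular_inner K_compact K_circle K_null e3 (ltW r0) r1 psiu psi1.
have [BN hk denB] := inner_mobius vN k1 gk hE.
set B := (fun z => _) in BN.
exists B; split.
- apply: (@finite_blaschke_inner _ (N + d).-1).
  by rewrite prednK // addn_gt0 d0 orbT.
- apply: (@supnorm_lt _ _ _ e) => //; first by lra.
  move=> z Kz; have z1 := K1 z Kz; have z0 := unit_neq0 z1; have pz := phi1 z Kz.
  have phiE : phi z = (g.[z] + a z) / (1 + conjc g.[z] * a z).
    have n1 : 1 - g.[z] * conjc g.[z] != 0.
      have -> : 1 - g.[z] * conjc g.[z] = (1 - nm g.[z] ^+ 2)%:C%C.
        by rewrite mul_conj rmorphB rmorph1.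
      rewrite -nm_gt0 nm_real normr_gt0 subr_eq0 gt_eqF //.
      by have := gk z z1; have := nm_ge0 g.[z]; nra.
    have n2 := den0 z Kz.
    have -> : 1 + conjc g.[z] * a z =
        (1 - g.[z] * conjc g.[z]) / (1 - conjc g.[z] * phi z) by rewrite /a; field.
    by rewrite /a; field; rewrite n1 n2.
  have BE : B z = (g.[z] + z ^+ d * v z) / (1 + conjc g.[z] * (z ^+ d * v z)).
    by rewrite /B hE //; congr (_ / (1 + _)); ring.
  have zv1 : nm (z ^+ d * v z) = 1 by rewrite nmM nmX z1 expr1n mul1r (inner_circle vN).
  rewrite /= BE [X in _ - X]phiE.
  apply: le_trans (mobius_lip (gk z z1) k1 zv1 (a1 z Kz)) _.
  rewrite subKr ler_pdivrMr ?exprn_gt0 // -exprS.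
  have -> : z ^+ d * v z - a z = z ^+ d * (v z - psi z).
    by rewrite /psi (conj_unit z1) exprVn; field; rewrite expf_neq0.
  by rewrite nmM nmX z1 expr1n mul1r vK.
- apply: (@supnorm_lt _ _ _ (5 * e)) => //; first by lra.
  move=> z Lz; have zr := Lr z Lz; have z1 : nm z <= 1 by apply: le_trans zr (ltW r1).
  have dB : e <= nm (1 + h.[z] * v z) by have := denB z z1; rewrite subKr.
  have zd : nm (z ^+ d) <= 1 by rewrite nmX exprn_ile1 ?nm_ge0.
  have g1 := le_trans (poly_max_principle gk z1) (ltW k1).
  have h1 := le_trans (hk z z1) (ltW k1).
  have ve : nm (v z) <= e * e.
    by apply: le_trans (vL z zr) _; rewrite exprS ler_wpM2l ?ltW // expr2; nra.
  have Bg : nm (B z - g.[z]) <= 2 * e := mobius_near zd g1 h1 e0 dB ve.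
  by have := gf z Lz; have := nm_tri (B z) g.[z] (f z); rewrite /=; lra.
Qed.
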